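(* Let $\mathcal A$ be a homogeneous constant-coefficient linear PDE operator of order $k$ on $\mathbb R^d$, from $V$ to $W$, and let $\mathcal K\subset V$ be a convex cone satisfying $\mathcal K\cap\Lambda_{\mathcal A}=\{0\}$. Then there are no non-zero solutions $u\in L^1(\mathbb R^d;V)$ of the homogeneous system $$\mathcal A u=0\ \text{ in }\mathcal D'(\mathbb R^d;W),\qquad u\in\mathcal K\ \text{ a.e. in }\mathbb R^d.$$
   Context: $V,W$ are finite-dimensional (real) inner product spaces. A homogeneous constant-coefficient linear PDE operator of order $k$ from $V$ to $W$ acts by $\mathcal A u=\sum_{|\alpha|=k}A_\alpha\partial^\alpha u$ with $A_\alpha\in\mathrm{Lin}(V,W)$. Its principal symbol is $\mathbb A(\xi)=(2\pi\mathrm i)^k\sum_{|\alpha|=k}A_\alpha\xi^\alpha$, $\xi\in\mathbb R^d$. The wave cone of $\mathcal A$ is $\Lambda_{\mathcal A}=\bigcup_{|\xi|=1}\ker\mathbb A(\xi)\subset V$ (the kernel being taken in $V$; the scalar $(2\pi\mathrm i)^k$ is irrelevant). *)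

(* Defs.v *)
From HB Require Import structures.
From mathcomp Require Import all_boot all_order all_algebra.
From mathcomp Require Import all_classical all_reals all_analysis.

Set Implicit Arguments.
Unset Strict Implicit.
Unset Printing Implicit Defensive.

Import Order.TTheory GRing.Theory Num.Theory.
Import numFieldNormedType.Exports.

Local Open Scope classical_set_scope.
Local Open Scope ring_scope.

Definition rV_display : measure_display.
Proof. exact: default_measure_display. Qed.

(* R^d is 'rV[R]_d. The sigma-algebra is the product one, generated by the
   coordinates (as for n.-tuple T in the library); since R is second countable
   it is the Borel sigma-algebra of R^d. *)
Section measurable_rV.
Variables (R : realType) (d : nat).

Let coor (i : 'I_d) (x : 'rV[R]_d) : measurableTypeR R := x ord0 i.

Let rV_set0 : g_sigma_preimage coor set0.
Proof. exact: sigma_algebra0. Qed.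

Let rV_setC A : g_sigma_preimage coor A -> g_sigma_preimage coor (~` A).
Proof. exact: sigma_algebraC. Qed.

Let rV_bigcup (F : (set 'rV[R]_d)^nat) :
  (forall i, g_sigma_preimage coor (F i)) ->
  g_sigma_preimage coor (\bigcup_i (F i)).
Proof. exact: sigma_algebra_bigcup. Qed.

HB.instance Definition _ := @isMeasurable.Build rV_display 'rV[R]_d
  (g_sigma_preimage coor) rV_set0 rV_setC rV_bigcup.

Lemma measurable_coor (i : 'I_d) :
  measurable_fun [set: 'rV[R]_d]
    ((fun x : 'rV[R]_d => x ord0 i) : 'rV[R]_d -> measurableTypeR R).
Proof.
move=> _ Y mY; rewrite setTI; apply: sub_sigma_algebra => /=.
rewrite -bigcup_seq/=; exists i => /=; first by rewrite mem_index_enum.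
by exists Y => //; rewrite setTI.
Qed.

Lemma measurable_fun_coorP (dT : measure_display) (T : measurableType dT)
    (f : T -> 'rV[R]_d) :
  measurable_fun [set: T] f <->
  forall i : 'I_d, measurable_fun [set: T]
    ((fun t => f t ord0 i) : T -> measurableTypeR R).
Proof.
split=> [mf i|mf].
  exact: (measurableT_comp (measurable_coor i) mf).
have mfS : g_sigma_preimage (fun i => coor i \o f) `<=` measurable.
  apply: smallest_sub; first exact: sigma_algebra_measurable.
  rewrite -bigcup_seq; apply: bigcup_sub => i _.
  by move=> A [B mB <-]; exact: mf.
move=> _ Y mY; rewrite setTI; apply: mfS; rewrite g_sigma_preimage_comp.
by exists Y => //; rewrite setTI.
Qed.

End measurable_rV.

Lemma sigma_finite_product (d1 d2 : measure_display) (T1 : measurableType d1)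
    (T2 : measurableType d2) (R : realType)
    (m1 : {sigma_finite_measure set T1 -> \bar R})
    (m2 : {sigma_finite_measure set T2 -> \bar R}) :
  sigma_finite setT (m1 \x m2)%E.
Proof.
have /sigma_finiteP[F [TF ndF Foo]] := sigma_finiteT m1.
have /sigma_finiteP[G [TG ndG Goo]] := sigma_finiteT m2.
exists (fun n => F n `*` G n).
  rewrite -setXTT TF TG predeqE => -[x y]; split.
    move=> [/= [n _ Fnx] [k _ Gky]]; exists (maxn n k) => //; split.
    - by move: x Fnx; exact/subsetPset/ndF/leq_maxl.
    - by move: y Gky; exact/subsetPset/ndG/leq_maxr.
  by move=> [n _ []/= ? ?]; split; exists n.
move=> k; have [? ?] := Foo k; have [? ?] := Goo k.
split; first exact: measurableX.
by rewrite product_measure1E// lte_mul_pinfty// ge0_fin_numE.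
Qed.

Section lebesgue_rV.
Variable R : realType.

Definition rV_cons (d : nat) (p : measurableTypeR R * 'rV[R]_d) : 'rV[R]_d.+1 :=
  \row_(i < d.+1) oapp (fun j => p.2 ord0 j) p.1 (unlift ord0 i).

Definition rV_uncons (d : nat) (x : 'rV[R]_d.+1) :
    measurableTypeR R * 'rV[R]_d :=
  (x ord0 ord0, \row_(j < d) x ord0 (lift ord0 j)).

Lemma rV_consK (d : nat) : cancel (@rV_cons d) (@rV_uncons d).
Proof.
move=> [a v]; rewrite /rV_uncons /rV_cons !mxE unlift_none /=; congr pair.
by apply/rowP => j; rewrite !mxE liftK.
Qed.

Lemma measurable_rV_cons (d : nat) : measurable_fun setT (@rV_cons d).
Proof.
apply/measurable_fun_coorP => i.
have [j ->|->] := unliftP ord0 i.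
  rewrite (_ : (fun t => _) = (fun x : 'rV[R]_d => x ord0 j) \o snd).
    exact: (measurableT_comp (measurable_coor j) measurable_snd).
  by apply/funext => t /=; rewrite !mxE liftK.
rewrite (_ : (fun t => _) = fst); first exact: measurable_fst.
by apply/funext => t /=; rewrite !mxE unlift_none.
Qed.

Lemma measurable_rV_uncons (d : nat) : measurable_fun setT (@rV_uncons d).
Proof.
apply/measurable_fun_pairP; split; first exact: measurable_coor.
apply/measurable_fun_coorP => i.
rewrite (_ : (fun t => _) = fun x : 'rV[R]_d.+1 => x ord0 (lift ord0 i)).
  exact: measurable_coor.
by apply/funext => t /=; rewrite !mxE.
Qed.

Section step.
Variables (d : nat) (m : {sigma_finite_measure set 'rV[R]_d -> \bar R}).

Definition lebesgue_step : set 'rV[R]_d.+1 -> \bar R :=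
  pushforward (@lebesgue_measure R \x m)%E (@rV_cons d).

Let mpre (A : set 'rV[R]_d.+1) :
  measurable A -> measurable (@rV_cons d @^-1` A).
Proof.
by move=> mA; rewrite -[X in measurable X]setTI; exact: measurable_rV_cons.
Qed.

Let step0 : lebesgue_step set0 = 0%E.
Proof. by rewrite /lebesgue_step /pushforward preimage_set0 measure0. Qed.

Let step_ge0 A : (0 <= lebesgue_step A)%E.
Proof. by rewrite /lebesgue_step /pushforward. Qed.

Let step_sigma_additive : semi_sigma_additive lebesgue_step.
Proof.
move=> F mF tF mUF; rewrite /lebesgue_step /pushforward preimage_bigcup.
apply: measure_semi_sigma_additive.
- by move=> n; exact: mpre.
- apply/trivIsetP => /= i j _ _ ij; rewrite -preimage_setI.
  by move/trivIsetP : tF => /(_ _ _ _ _ ij) ->//; rewrite preimage_set0.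
- by rewrite -preimage_bigcup; exact: mpre.
Qed.

HB.instance Definition _ := isMeasure.Build _ _ _
  lebesgue_step step0 step_ge0 step_sigma_additive.

Let step_sigma_finite : sigma_finite setT lebesgue_step.
Proof.
have [F FT Foo] : sigma_finite setT (@lebesgue_measure R \x m)%E.
  exact: (sigma_finite_product (@lebesgue_measure R) m).
exists (fun n => @rV_uncons d @^-1` F n).
  by rewrite -preimage_bigcup -FT preimage_setT.
move=> n; have [mF Fn] := Foo n; split.
  by rewrite -[X in measurable X]setTI; exact: measurable_rV_uncons.
rewrite /lebesgue_step /pushforward /= -comp_preimage.
by rewrite (_ : _ \o _ = id) //; apply/funext => p /=; rewrite rV_consK.
Qed.

HB.instance Definition _ := Measure_isSigmaFinite.Build _ _ _
  lebesgue_step step_sigma_finite.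

End step.

(* d-dimensional Lebesgue measure, as the d-fold product of lebesgue_measure. *)
Fixpoint lebesgue_rV (d : nat) :
    {sigma_finite_measure set 'rV[R]_d -> \bar R} :=
  if d is d'.+1 return {sigma_finite_measure set 'rV[R]_d -> \bar R}
  then lebesgue_step (lebesgue_rV d')
  else \d_(0 : 'rV[R]_0).

Lemma lebesgue_rV_box (d : nat) (A : 'I_d -> set (measurableTypeR R)) :
  (forall i, measurable (A i)) ->
  lebesgue_rV d [set x : 'rV[R]_d | forall i, A i (x ord0 i)] =
  (\prod_(i < d) lebesgue_measure (A i))%E.
Proof.
elim: d A => [|d IH] A mA /=.
  by rewrite big_ord0 diracE mem_set //; case.
rewrite big_ord_recl /lebesgue_step /pushforward.
rewrite (_ : _ @^-1` _ = A ord0 `*`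
    [set x : 'rV[R]_d | forall i, A (lift ord0 i) (x ord0 i)]); last first.
  apply/seteqP; split=> [[a v] /= H|[a v] /= [Ha Hv] i].
    split=> [|i] /=.
      by have := H ord0; rewrite mxE unlift_none.
    by have := H (lift ord0 i); rewrite mxE liftK.
  rewrite mxE; have [j ->|->] := unliftP ord0 i; last by [].
  exact: Hv.
rewrite product_measure1E //; first by congr (_ * _)%E; exact: IH.
rewrite (_ : [set x | _] = \bigcap_(i in [set: 'I_d])
    ((fun x : 'rV[R]_d => x ord0 i) @^-1` A (lift ord0 i))); last first.
  by apply/seteqP; split=> [x /= H i _|x /= H i]; [exact: H|exact: (H i)].
apply: fin_bigcap_measurable => // i _.
by rewrite -[X in measurable X]setTI; exact: measurable_coor.
Qed.

End lebesgue_rV.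

Section convex_cones.
Variables (R : realType) (V : lmodType R).

Definition convex_cone (K : set (convex_lmodType V)) :=
  convex_set K /\ forall (t : R) (v : V), 0 < t -> K v -> K (t *: v).

End convex_cones.

Section function_spaces.
Variables (R : realType) (d : nat).

Section vector_valued.
Variable V : vectType R.

(* Vector-valued functions are measured and integrated componentwise, in the
   library's basis vbasis fullv of V; the choice of the basis is irrelevant. *)
Definition vcoord (i : 'I_(\dim {:V})) (v : V) : R := coord (vbasis {:V}) i v.

Definition Vintegral (f : 'rV[R]_d -> V) : V :=
  \sum_(i < \dim {:V})
    (\int[lebesgue_rV R d]_x vcoord i (f x)) *: (vbasis {:V})`_i.

Definition dotnorm (dot : {dot V for idfun}) (v : V) : R :=
  Num.sqrt (dot v v).

(* u is a representative of an element of L^1(R^d; V). *)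
Definition L1 (dot : {dot V for idfun}) (u : 'rV[R]_d -> V) :=
  (forall i, measurable_fun [set: 'rV[R]_d] (fun x => vcoord i (u x))) /\
  (lebesgue_rV R d).-integrable [set: 'rV[R]_d]
    (fun x => (dotnorm dot (u x))%:E).

End vector_valued.

Definition partial (i : 'I_d) (f : 'rV[R]_d -> R) : 'rV[R]_d -> R :=
  'D_(delta_mx ord0 i) f.

Definition iter_partial (s : seq 'I_d) (f : 'rV[R]_d -> R) : 'rV[R]_d -> R :=
  foldr partial f s.

Definition smooth (f : 'rV[R]_d -> R) :=
  forall s : seq 'I_d, continuous (iter_partial s f) /\
    forall (i : 'I_d) (x : 'rV[R]_d),
      derivable (iter_partial s f) x (delta_mx ord0 i).

Definition test_function (phi : 'rV[R]_d -> R) :=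
  smooth phi /\ compact (closure [set x | phi x != 0]).

End function_spaces.

Section multi_indices.
Variables (d k : nat).

(* Multi-indices of length |alpha| = k: each entry is at most k. *)
Definition multi_index :=
  {alpha : {ffun 'I_d -> 'I_k.+1} | (\sum_(i < d) alpha i == k)%N}.

Definition mi (alpha : multi_index) (i : 'I_d) : nat := val alpha i.

End multi_indices.

Definition partial_mi (R : realType) (d k : nat) (alpha : multi_index d k)
    (f : 'rV[R]_d -> R) : 'rV[R]_d -> R :=
  foldr (fun i g => iter (mi alpha i) (partial i) g) f (enum 'I_d).

Section operators.
Variables (R : realType) (d k : nat) (V W : vectType R).

(* A homogeneous constant-coefficient operator of order k on R^d from V to W
   is given by its coefficients A_alpha in Lin(V, W), |alpha| = k. *)
Definition pde_operator := multi_index d k -> 'Hom(V, W).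

Variable A : pde_operator.

(* The principal symbol without the scalar (2 pi i)^k, which is nonzero and
   hence does not affect the kernel. *)
Definition symbol (xi : 'rV[R]_d) : 'Hom(V, W) :=
  \sum_(alpha : multi_index d k)
    (\prod_(i < d) xi ord0 i ^+ mi alpha i) *: A alpha.

Definition wave_cone : set V :=
  \bigcup_(xi in [set xi : 'rV[R]_d |
                   Num.sqrt (\sum_(i < d) xi ord0 i ^+ 2) = 1])
    [set v | v \in lker (symbol xi)].

(* The pairing <d^alpha u, phi> = (-1)^|alpha| int u d^alpha phi in V. *)
Definition distr_partial (alpha : multi_index d k) (u : 'rV[R]_d -> V)
    (phi : 'rV[R]_d -> R) : V :=
  (-1) ^+ k *: Vintegral (fun x => partial_mi alpha phi x *: u x).

Definition distr_apply (u : 'rV[R]_d -> V) (phi : 'rV[R]_d -> R) : W :=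
  \sum_(alpha : multi_index d k) A alpha (distr_partial alpha u phi).

(* A u = 0 in D'(R^d; W), the W-valued distributions being linear maps
   from scalar test functions to W. *)
Definition distr_solution (u : 'rV[R]_d -> V) :=
  forall phi : 'rV[R]_d -> R, test_function phi -> distr_apply u phi = 0.

End operators.

(* Main.v *)
Require Import Defs.
From HB Require Import structures.
From mathcomp Require Import all_boot all_order all_algebra.
From mathcomp Require Import all_classical all_reals all_analysis
  measurable_realfun.
From mathcomp Require Import ring lra.

Set Implicit Arguments.
Unset Strict Implicit.
Unset Printing Implicit Defensive.

Import Order.TTheory GRing.Theory Num.Theory.
Import numFieldNormedType.Exports.

Local Open Scope classical_set_scope.
Local Open Scope ring_scope.

(** Write [<xi, x>] for the Euclidean pairing. The equation for [u] becomes, for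
    its Fourier transform, the family of linear equations
      A(xi) (int cos(<xi, x> + b) u(x) dx) = 0   for all xi and b,
    so each of these integrals with [xi] nonzero lies in the wave cone, because
    the symbol is homogeneous and [xi] can be normalised. Replacing [xi] by
    [xi / n] and letting [n] tend to infinity, the mean [int u] is annihilated by
    [A(xi)] for every [xi], so it lies in the wave cone too.

    On the other side, integrating [u] against a bounded nonnegative weight gives
    an element of the convex cone [K]. The weight 1 shows that [int u] lies in
    [K], hence [int u = 0]. This alone does not give [u = 0], since [K] may
    contain lines. But then the nonnegative weight [1 + cos(<xi, x> + b)] shows
    that [int cos(<xi, x> + b) u] lies in [K], hence vanishes as well, for all
    [xi] and [b]. The Fourier transform of [u] is therefore zero, and so is [u].

    Three facts carry this argument.
    - [Vintegral_cone]: in finite dimension, the integral of a function with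
      values in a convex cone lies in the cone. It rests on the separation of a
      point from a convex cone ([maximal_cone] and [total_cone_functional]).
    - [symbol_wave]: the equation, given for compactly supported test functions,
      may be tested against plane waves. These are the limits of their products
      with dilated cutoffs, with uniform bounds on all derivatives
      ([truncated_wave_cvg]), and dominated convergence applies.
    - [fourier_null_ae0]: an integrable function whose integrals against all
      plane waves vanish is zero almost everywhere. The bounded functions by
      which one may multiply without leaving the class of such functions form an
      algebra stable under bounded pointwise limits; it contains the plane waves,
      hence the indicators of half-spaces, hence those of all measurable sets. *)

(** * Separating a point from a convex cone *)

Section separation.
Variables (R : realType) (V : vectType R).

Definition cone (C : set V) :=
  [/\ C 0, forall x y, C x -> C y -> C (x + y) &
      forall (t : R) x, 0 <= t -> C x -> C (t *: x)].

(** By Zorn's lemma there is a maximal cone M containing K and not v. If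
    neither x nor - x were in M, both cones M + R+ x and M + R+ (- x) would
    contain v, and a convex combination of the two expressions of v would put
    v in M. *)
Lemma maximal_cone (K : set V) (v : V) : cone K -> ~ K v ->
  exists M : set V, [/\ cone M, K `<=` M, ~ M v & forall x, M x \/ M (- x)].
Proof.
move=> [K0 KD KZ] Kv.
(* The last clause is conditional so that the empty chain has an upper bound. *)
pose P (M : set V) := [/\ forall x y, M x -> M y -> M (x + y),
  forall (t : R) x, 0 <= t -> M x -> M (t *: x), ~ M v & M !=set0 -> K `<=` M].
have [F FP totF|M [[MD MZ Mv MK] Mmax]] := @Zorn_bigcup V P.
  split.
  - move=> x y [X FX Xx] [Y FY Yy].
    have [XY|YX] := totF _ _ FX FY.
      by exists Y => //; have [D _ _ _] := FP _ FY; apply: D => //; exact: XY.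
    by exists X => //; have [D _ _ _] := FP _ FX; apply: D => //; exact: YX.
  - move=> t x t0 [X FX Xx]; exists X => //.
    by have [_ Z _ _] := FP _ FX; exact: Z.
  - by move=> [X FX Xv]; have [_ _ + _] := FP _ FX.
  - move=> [x [X FX Xx]] y Ky; exists X => //.
    by have [_ _ _ XK] := FP _ FX; apply: XK => //; exists x.
have M0 : M !=set0.
  apply/set0P/negP => /eqP M0; apply: (Mmax K).
    by rewrite M0; split=> [x []|/(_ _ K0)].
  by split=> // _ x.
have {}MK := MK M0.
(* By maximality, adjoining a half-line outside M captures v. *)
have ext x : ~ M x -> exists2 s : R, 0 < s & exists2 m, M m & v = m + s *: x.
  move=> Mx; apply: contrapT => noext.
  pose Mx' := [set y | exists2 s : R, 0 <= s & exists2 m, M m & y = m + s *: x].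
  have MMx : M `<=` Mx'.
    by move=> m Mm; exists 0 => //; exists m => //; rewrite scale0r addr0.
  apply: (Mmax Mx').
    split=> // MxM; apply/Mx/MxM.
    by exists 1 => //; exists 0; [exact: MK|rewrite add0r scale1r].
  split.
  - move=> _ _ [s s0 [m Mm ->]] [t t0 [n Mn ->]]; exists (s + t).
      exact: addr_ge0.
    by exists (m + n); [exact: MD|rewrite scalerDl addrACA].
  - move=> t _ t0 [s s0 [m Mm ->]]; exists (t * s); first exact: mulr_ge0.
    by exists (t *: m); [exact: MZ|rewrite scalerDr scalerA].
  - move=> [s s0 [m Mm vE]]; apply: noext.
    have [s00|sN0] := eqVneq s 0.
      by exfalso; apply: Mv; rewrite vE s00 scale0r addr0.
    by exists s; [rewrite lt_neqAle eq_sym sN0|exists m].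
  - by move=> _ y /MK /MMx.
exists M; split => //; first by split => //; exact: MK.
move=> x; apply: contrapT => /not_orP[Mx Mnx].
have [s s0 [m Mm vE]] := ext _ Mx.
have [t t0 [n Mn vE']] := ext _ Mnx.
apply: Mv.
have stN0 : s + t != 0 by rewrite gt_eqF// addr_gt0.
suff -> : v = (s + t)^-1 *: (t *: m + s *: n).
  apply: (MZ); first by rewrite invr_ge0 addr_ge0// ltW.
  by apply: (MD); apply: (MZ) => //; exact: ltW.
have -> : t *: m + s *: n = (s + t) *: v.
  rewrite (_ : t *: m = t *: v - (t * s) *: x); last first.
    by rewrite vE scalerDr scalerA addrK.
  rewrite (_ : s *: n = s *: v + (s * t) *: x); last first.
    by rewrite vE' scalerN scalerDr scalerN scalerA subrK.
  by rewrite addrACA -scalerDl (mulrC t) addNr addr0 addrC.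
by rewrite scalerA mulVf// scale1r.
Qed.

(** The cone M is the positive cone of a total preorder on V, which has an order
    unit e because V has finite dimension. The functional sends x to the
    supremum of the c with c e below x; totality makes this superadditive gauge additive. *)
Lemma total_cone_functional (M : set V) (v : V) :
  cone M -> (forall x, M x \/ M (- x)) -> ~ M v ->
  exists l : 'Hom(V, R^o), [/\ forall x, M x -> 0 <= l x, l v <= 0 & l != 0].
Proof.
move=> [M0 MD MZ] Mtot Mv.
pose b i := (vbasis {:V})`_i.
(* Signs that move the vectors of the basis into M. *)
have [eps epsM] : exists eps : 'I_(\dim {:V}) -> R,
    forall i, eps i * eps i = 1 /\ M (eps i *: b i).
  suff /choice[eps epsM] : forall i : 'I_(\dim {:V}), exists a : R,
      a * a = 1 /\ M (a *: b i) by exists eps.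
  move=> i; have [Mb|Mb] := Mtot (b i).
    by exists 1; rewrite mulr1 scale1r.
  by exists (-1); rewrite mulrNN mulr1 scaleN1r.
have Msum (f : 'I_(\dim {:V}) -> V) : (forall i, M (f i)) -> M (\sum_i f i).
  by move=> Mf; elim/big_ind : _ => //; exact: MD.
pose e := \sum_i eps i *: b i.
have Me : M e by apply: Msum => i; case: (epsM i).
(* e is an order unit: the coordinates of x are absorbed one by one. *)
have unit_e x : exists2 c, 0 <= c & M (x + c *: e).
  pose c := \sum_i `|coord (vbasis {:V}) i x|; exists c; first exact: sumr_ge0.
  rewrite {1}(coord_vbasis (memvf x)) scaler_sumr -big_split/=.
  apply: Msum => i; have [ee Mei] := epsM i.
  set xi := coord _ i x.
  suff -> : xi *: (vbasis {:V})`_i + c *: (eps i *: b i)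
      = (eps i * xi + c) *: (eps i *: b i).
    apply: (MZ) => //; rewrite -lerBlDr sub0r.
    have : `|eps i * xi| <= c.
      have /eqP : `|eps i| * `|eps i| = 1 by rewrite -normrM ee normr1.
      rewrite -expr2 sqrp_eq1// => /eqP e1.
      by rewrite normrM e1 mul1r /c (bigD1 i)//= lerDl sumr_ge0.
    by rewrite ler_norml => /andP[].
  by rewrite !scalerA -scalerDl mulrDl mulrAC ee mul1r.
have Mne : ~ M (- e).
  move=> Mne; apply: Mv; have [c c0 Mc] := unit_e v.
  have := MD _ _ Mc (MZ _ _ c0 Mne).
  by rewrite scalerN addrK.
have Mce c : M (c *: e) -> 0 <= c.
  move=> Mc; rewrite leNgt; apply/negP => c0; apply: Mne.
  have := MZ (- c^-1) _ _ Mc; rewrite scalerA mulNr mulVf ?lt_eqF// scaleN1r.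
  by apply; rewrite oppr_ge0 invr_le0 ltW.
pose S x := [set c | M (x - c *: e)].
pose l x := sup (S x).
have supS x : has_sup (S x).
  split.
    have [c c0 Mc] := unit_e x; exists (- c).
    by rewrite /S/= scaleNr opprK.
  have [c c0 Mc] := unit_e (- x); exists c => c'; rewrite /S/= => Mc'.
  rewrite -subr_ge0; apply: Mce.
  by have := MD _ _ Mc Mc'; rewrite addrACA addNr add0r -scaleNr -scalerDl.
have l_lt x c : c < l x -> M (x - c *: e).
  move=> cl; have [c' Sc' cc'] := sup_gt (supS x).1 cl.
  have -> : x - c *: e = x - c' *: e + (c' - c) *: e.
    by rewrite scalerBl subrKA.
  by apply: (MD) => //; apply: (MZ) => //; rewrite subr_ge0 ltW.
have l_gt x c : l x < c -> M (c *: e - x).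
  move=> lc; have [Mc|] := Mtot (x - c *: e); last by rewrite opprB.
  by have := ub_le_sup (supS x).2 Mc; rewrite leNgt lc.
have cut x p q : M (x - p *: e) -> M (q *: e - x) -> p <= q.
  move=> Ma Mb; rewrite -subr_ge0; apply: Mce.
  by have := MD _ _ Mb Ma; rewrite addrA subrK -scalerBl.
(* l x is characterised by the sections of M on both sides. *)
have l_uniq x r : (forall c, c < r -> M (x - c *: e)) ->
    (forall c, r < c -> M (c *: e - x)) -> l x = r.
  move=> ltr gtr; apply/eqP; rewrite eq_le; apply/andP; split.
    rewrite leNgt; apply/negP => rl.
    have Ma : M (x - ((r + 3 * l x) / 4) *: e) by apply: l_lt; lra.
    have Mb : M (((3 * r + l x) / 4) *: e - x) by apply: gtr; lra.
    by have := cut _ _ _ Ma Mb; lra.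
  rewrite leNgt; apply/negP => rl.
  have Ma : M (x - ((l x + 3 * r) / 4) *: e) by apply: ltr; lra.
  have Mb : M (((3 * l x + r) / 4) *: e - x) by apply: l_gt; lra.
  by have := cut _ _ _ Ma Mb; lra.
have lD x y : l (x + y) = l x + l y.
  apply: (l_uniq) => c cl.
    pose t := (l x + l y - c) / 2.
    have -> : x + y - c *: e = x - (l x - t) *: e + (y - (l y - t) *: e).
      rewrite addrACA -opprD -scalerDl; congr (_ - _ *: _).
      by rewrite /t; field.
    by apply: (MD); apply: (l_lt); rewrite /t; lra.
  pose t := (c - l x - l y) / 2.
  have -> : c *: e - (x + y) = (l x + t) *: e - x + ((l y + t) *: e - y).
    rewrite addrACA -opprD -scalerDl; congr (_ *: _ - _).
    by rewrite /t; field.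
  by apply: (MD); apply: (l_gt); rewrite /t; lra.
have l0 : l 0 = 0 by have := lD 0 0; rewrite addr0 => h; lra.
have lN x : l (- x) = - l x.
  by have := lD x (- x); rewrite subrr l0 => h; lra.
have lZ0 t x : 0 <= t -> l (t *: x) = t * l x.
  rewrite le_eqVlt => /predU1P[<-|t0]; first by rewrite scale0r mul0r.
  have tN0 : t != 0 by rewrite gt_eqF.
  apply: (l_uniq) => c cl.
    have -> : t *: x - c *: e = t *: (x - (c / t) *: e).
      by rewrite scalerBr scalerA mulrCA mulfV// mulr1.
    by apply: (MZ); [exact: ltW|apply: (l_lt); rewrite ltr_pdivrMr// mulrC].
  have -> : c *: e - t *: x = t *: ((c / t) *: e - x).
    by rewrite scalerBr scalerA mulrCA mulfV// mulr1.
  by apply: (MZ); [exact: ltW|apply: (l_gt); rewrite ltr_pdivlMr// mulrC].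
have lZ t x : l (t *: x) = t * l x.
  have [t0|t0] := leP 0 t; first exact: lZ0.
  rewrite -[t in LHS]opprK scaleNr lN lZ0 ?oppr_ge0 ?ltW//.
  by rewrite mulNr opprK.
have lin : linear (l : V -> R^o) by move=> t x y; rewrite lD lZ.
pose lL := GRing.isLinear.Build _ _ _ _ (l : V -> R^o) lin.
pose l' : {linear V -> R^o} := HB.pack (l : V -> R^o) lL.
have l_ge0 x : M x -> 0 <= l x.
  move=> Mx; apply: ub_le_sup; first exact: (supS x).2.
  by rewrite /S/= scale0r subr0.
exists (linfun l'); split.
- by move=> x Mx; rewrite lfunE; exact: l_ge0.
- rewrite lfunE/= -oppr_ge0 -lN; apply: l_ge0.
  by case: (Mtot v).
- apply/negP => /eqP /lfunP/(_ e); rewrite lfunE lfunE/= => le0.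
  have /Mce : M ((1 / 2 - 1) *: e).
    by rewrite scalerBl scale1r; apply: (l_gt); rewrite le0; lra.
  by lra.
Qed.

End separation.

(** * Integrals of functions with values in a convex cone *)

Section integrals.
Variables (R : realType) (d : nat) (V : vectType R).
Local Notation mu := (lebesgue_rV R d).

Lemma integrable_addr (f g : 'rV[R]_d -> R) :
  mu.-integrable setT (EFin \o f) -> mu.-integrable setT (EFin \o g) ->
  mu.-integrable setT (EFin \o (fun x => f x + g x)).
Proof.
move=> fi gi; rewrite (_ : _ \o _ = ((EFin \o f) \+ (EFin \o g))%E)//.
exact: integrableD.
Qed.

Lemma Rintegral_sum (I : Type) (s : seq I) (f : I -> 'rV[R]_d -> R) :
  (forall i, mu.-integrable setT (EFin \o f i)) ->
  mu.-integrable setT (EFin \o (fun x => \sum_(i <- s) f i x)) /\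
  (\int[mu]_x (\sum_(i <- s) f i x) = \sum_(i <- s) \int[mu]_x f i x).
Proof.
move=> fi; elim: s => [|i s [IH IHE]].
  split.
    by rewrite (_ : _ \o _ = cst 0%E);
      [exact: integrable0|apply/funext => x /=; rewrite big_nil].
  under eq_Rintegral do rewrite big_nil.
  by rewrite big_nil Rintegral_cst// mul0r.
split.
  under [X in EFin \o X]eq_fun do rewrite big_cons.
  exact: integrable_addr.
under eq_Rintegral do rewrite big_cons.
by rewrite big_cons RintegralD// IHE.
Qed.

Definition coord_integrable (f : 'rV[R]_d -> V) :=
  forall i, mu.-integrable setT (EFin \o (fun x => vcoord i (f x))).

Lemma vcoord_sum (v : V) : v = \sum_i vcoord i v *: (vbasis {:V})`_i.
Proof. exact/coord_vbasis/memvf. Qed.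

Lemma lfun_Vintegral (l : 'Hom(V, R^o)) (f : 'rV[R]_d -> V) :
  coord_integrable f ->
  mu.-integrable setT (EFin \o (fun x => l (f x))) /\
  l (Vintegral f) = \int[mu]_x (l (f x) : R).
Proof.
move=> fi; pose g i x := vcoord i (f x) * l (vbasis {:V})`_i.
have lE x : l (f x) = \sum_i g i x.
  rewrite [in LHS](vcoord_sum (f x)) linear_sum/=.
  by apply: eq_bigr => i _; rewrite linearZ.
have gi i : mu.-integrable setT (EFin \o g i).
  rewrite (_ : _ \o _ = ((EFin \o (fun x => vcoord i (f x))) \*
      cst (l (vbasis {:V})`_i : R)%:E)%E)//.
  exact: integrableZr.
have [sumi sumE] := Rintegral_sum (index_enum _) gi.
have lfE : (fun x => l (f x) : R) = (fun x => \sum_i g i x).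
  by apply/funext => x; rewrite lE.
rewrite lfE; split=> //.
rewrite sumE /Vintegral linear_sum/=; apply: eq_bigr => i _.
by rewrite linearZ/= RintegralZr//; exact: fi.
Qed.

(** The functional separating the integral from the cone has integral at most
    zero, hence vanishes almost everywhere on the values of the function; these
    values then lie in a smaller subspace. Starting from a smallest subspace
    containing almost every value, this is impossible. The descent to subspaces
    deals with the boundary of the cone, which may be missing from it. *)
Lemma Vintegral_cone (K : set V) (f : 'rV[R]_d -> V) :
  cone K -> coord_integrable f ->
  {ae mu, forall x, K (f x)} -> K (Vintegral f).
Proof.
move=> [K0 KD KZ] fi fK.
pose Q n := `[< exists2 U : {vspace V}, \dim U = n &
  {ae mu, forall x, f x \in U} >].
have exQ : exists n, Q n.
  exists (\dim {:V}); apply/asboolP; exists fullv => //.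
  by apply: aeW => x; rewrite memvf.
have [n /asboolP[U dimU fU] nmin] := ex_minnP exQ.
set v := Vintegral f.
(* Each coordinate of x - projv U x is a functional that vanishes on U. *)
have vU : v = projv U v.
  apply/eqP; rewrite -subr_eq0; apply/eqP.
  rewrite [LHS]vcoord_sum big1// => i _.
  pose l : 'Hom(V, R^o) :=
    (linfun (coord (vbasis {:V}) i : V -> R^o) \o (\1 - projv U))%VF.
  have lE w : l w = vcoord i (w - projv U w).
    by rewrite comp_lfunE add_lfunE opp_lfunE id_lfunE lfunE.
  rewrite -lE; have [lfi ->] := lfun_Vintegral l fi.
  rewrite (_ : (\int[mu]_x _)%R = 0) ?scale0r//.
  rewrite /Rintegral (ae_eq_integral (cst 0%E))//=.
  - by rewrite integral0.
  - exact: (measurable_int mu).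
  - apply: filterS fU => x fxU _ /=.
    by rewrite lE projv_id// subrr /vcoord linear0.
apply: contrapT => Kv.
(* Cones in U are separated in V after adding a complement of U to them, so that
   the functional is not identically zero on U. *)
pose K' := [set x | K (projv U x)].
have K'v : ~ K' v by rewrite /K'/= -vU.
have coneK' : cone K'.
  split; first by rewrite /K'/= linear0.
    by move=> x y Kx Ky; rewrite /K'/= linearD; exact: KD.
  by move=> t x t0 Kx; rewrite /K'/= linearZ; exact: KZ.
have [M [coneM KM Mv Mtot]] := maximal_cone coneK' K'v.
have [l [lM lv l0]] := total_cone_functional coneM Mtot Mv.
have [lfi lvE] := lfun_Vintegral l fi.
have lK x : K (projv U x) -> 0 <= l x by move=> Kx; exact/lM/KM.
(* l vanishes on the kernel of the projection, which is contained in K'. *)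
have lproj x : l x = l (projv U x).
  apply/eqP; rewrite -subr_eq0 -linearB; apply/eqP/le_anti/andP; split.
    by rewrite -oppr_ge0 -linearN; apply: lK;
      rewrite linearN linearB/= projv_proj subrr oppr0.
  by apply: lK; rewrite linearB/= projv_proj subrr.
have lf0 : {ae mu, forall x, l (f x) = 0}.
  have : ae_eq mu setT (EFin \o (fun x => l (f x))) (cst 0%E).
    apply/(ae_eq_integral_abs _ measurableT); first exact: (measurable_int mu).
    have absE : (\int[mu]_x `|(EFin \o (fun x => l (f x) : R)) x| =
        (l v : R)%:E)%E.
      rewrite lvE /Rintegral fineK; last exact: integrable_fin_num.
      apply: ae_eq_integral => //.
      - by apply: measurableT_comp => //; exact: (measurable_int mu).
      - exact: (measurable_int mu).
      - apply: filterS2 fU fK => x fxU fxK _ /=.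
        by rewrite ger0_norm//; apply: lK; rewrite projv_id.
    apply/le_anti/andP; split; first by rewrite absE lee_fin.
    exact: integral_ge0.
  by apply: filterS => x /(_ Logic.I)[].
have : Q (\dim (U :&: lker l)).
  apply/asboolP; exists (U :&: lker l)%VS => //.
  by apply: filterS2 fU lf0 => x fxU lfx; rewrite memv_cap fxU memv_ker lfx
    eqxx.
move=> /nmin; rewrite -dimU leqNgt => /negP; apply.
rewrite ltn_neqAle dimvS ?capvSl// andbT.
apply: contra l0 => /eqP dimE.
have /eqP UE : (U :&: lker l == U)%VS by rewrite eqEdim capvSl dimE leqnn.
apply/eqP/lfunP => x; rewrite lproj lfunE/=; apply/eqP.
rewrite -memv_ker; apply: (subvP (capvSr U (lker l))).
by rewrite UE memv_proj.
Qed.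

End integrals.

(** * Bounded multipliers and dominated convergence *)

Section bounded_multipliers.
Variables (R : realType) (d : nat).
Local Notation mu := (lebesgue_rV R d).
Local Notation rV := 'rV[R]_d.

Definition mbounded (g : rV -> R) :=
  measurable_fun [set: rV] g /\ exists C : R, forall x, `|g x| <= C.

Lemma mboundedM (g h : rV -> R) : mbounded g -> mbounded h ->
  mbounded (fun x => g x * h x).
Proof.
move=> [mg [C gC]] [mh [D hD]]; split; first exact: measurable_funM.
exists (C * D) => x; rewrite normrM; exact: ler_pM.
Qed.

Lemma mboundedD (g h : rV -> R) : mbounded g -> mbounded h ->
  mbounded (fun x => g x + h x).
Proof.
move=> [mg [C gC]] [mh [D hD]]; split; first exact: measurable_funD.
by exists (C + D) => x; rewrite (le_trans (ler_normD _ _))// lerD.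
Qed.

Lemma mbounded_cst (c : R) : mbounded (fun=> c).
Proof. by split; [exact: measurable_cst|exists `|c|]. Qed.

Lemma mbounded_cvg (g_ : nat -> rV -> R) (g : rV -> R) (C : R) :
  (forall n, mbounded (g_ n)) -> (forall n x, `|g_ n x| <= C) ->
  (forall x, g_ n x @[n --> \oo] --> g x) -> mbounded g.
Proof.
move=> mg_ gC cvg_g; split.
  apply: (measurable_fun_cvg (h := g_)) => [n|x _]; last exact: cvg_g.
  by case: (mg_ n).
exists C => x; apply: (cvgr_to_le (cvg_norm (cvg_g x))).
by apply: nearW => n; exact: gC.
Qed.

Lemma integrable_mbounded (g f : rV -> R) : mbounded g ->
  mu.-integrable setT (EFin \o f) ->
  mu.-integrable setT (EFin \o (fun x => g x * f x)).
Proof.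
move=> [mg [C gC]] fi.
rewrite (_ : _ \o _ = ((EFin \o g) \* (EFin \o f))%E); last by apply/funext.
apply: integrableMr => //; exists C; split; first exact: num_real.
by move=> M CM x _ /=; rewrite (le_trans (gC x))// ltW.
Qed.

Lemma Rintegral_cvg (g_ : nat -> rV -> R) (g f : rV -> R) (C : R) :
  mu.-integrable setT (EFin \o f) ->
  (forall n, mbounded (g_ n)) -> (forall n x, `|g_ n x| <= C) ->
  (forall x, g_ n x @[n --> \oo] --> g x) ->
  \int[mu]_x (g_ n x * f x) @[n --> \oo] --> \int[mu]_x (g x * f x).
Proof.
move=> fi mg_ gC cvg_g.
have mg : mbounded g by exact: mbounded_cvg mg_ gC cvg_g.
have gfi := integrable_mbounded mg fi.
have int_gf n := integrable_mbounded (mg_ n) fi.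
apply: fine_cvg; rewrite fineK; last exact: integrable_fin_num.
have [] // := @dominated_convergence _ _ _ mu setT measurableT
  (fun n => EFin \o (fun x => g_ n x * f x)) (EFin \o (fun x => g x * f x))
  (fun x => (`|C * f x|)%:E).
- by move=> n; exact: (measurable_int mu).
- exact: (measurable_int mu).
- apply: aeW => x _; apply: cvg_EFin; first exact: nearW.
  by apply: cvgMr_tmp; exact: cvg_g.
- apply: (@eq_integrable _ _ _ _ _ _
    (abse \o (EFin \o (fun x => C * f x)))) => //.
  apply: integrable_abse.
  exact: (integrable_mbounded (mbounded_cst C)).
- apply: aeW => x n _; rewrite lee_fin !normrM ler_wpM2r//.
  by rewrite (le_trans (gC n x))// ler_norm.
Qed.

End bounded_multipliers.

(** * Uniqueness for the Fourier transform *)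

Section fourier_uniqueness.
Variables (R : realType) (d : nat).
Local Notation mu := (lebesgue_rV R d).
Local Notation rV := 'rV[R]_d.

Definition rVdot (xi x : rV) : R := \sum_i xi ord0 i * x ord0 i.

Lemma rVdotC xi x : rVdot xi x = rVdot x xi.
Proof. by apply: eq_bigr => i _; rewrite mulrC. Qed.

Lemma rVdotDl xi eta x : rVdot (xi + eta) x = rVdot xi x + rVdot eta x.
Proof.
by rewrite /rVdot -big_split/=; apply: eq_bigr => i _; rewrite mxE mulrDl.
Qed.

Lemma rVdotZl t xi x : rVdot (t *: xi) x = t * rVdot xi x.
Proof.
by rewrite /rVdot mulr_sumr; apply: eq_bigr => i _; rewrite mxE mulrA.
Qed.

Lemma rVdotNl xi x : rVdot (- xi) x = - rVdot xi x.
Proof. by rewrite -scaleN1r rVdotZl mulN1r. Qed.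

Lemma rVdot0l x : rVdot 0 x = 0.
Proof. by rewrite -(scale0r 0) rVdotZl mul0r. Qed.

Lemma rVdot_delta i x : rVdot (delta_mx ord0 i) x = x ord0 i.
Proof.
rewrite /rVdot (bigD1 i)//= mxE !eqxx mul1r big1 ?addr0// => j ji.
by rewrite mxE (negPf ji) andbF mul0r.
Qed.

Lemma measurable_rVdot xi : measurable_fun [set: rV] (rVdot xi).
Proof.
apply: measurable_sum => i; apply: measurable_funM; first exact: measurable_cst.
exact: measurable_coor.
Qed.

Definition wave (xi : rV) (b : R) (x : rV) : R := cos (rVdot xi x + b).

Lemma mbounded_wave xi b : mbounded (wave xi b).
Proof.
split; last by exists 1 => x; exact: cos_max.
apply: (measurableT_comp (f := @cos R)).
  by apply: continuous_measurable_fun; exact: continuous_cos.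
by apply: measurable_funD; [exact: measurable_rVdot|exact: measurable_cst].
Qed.

(** Phases b = 0 and b = - pi / 2 give the real and imaginary parts of the
    Fourier transform of f; allowing all phases makes the products of waves
    again combinations of waves. *)
Definition fourier_null (f : rV -> R) := mu.-integrable setT (EFin \o f) /\
  forall xi b, \int[mu]_x (wave xi b x * f x) = 0.

(** Every bounded measurable function turns out to be of this kind, which is how
    uniqueness is proved: the sign of f is one, and |f| is then null. The class
    is an algebra by its very form. *)
Definition multiplier (m : rV -> R) := mbounded m /\
  forall f, fourier_null f -> fourier_null (fun x => m x * f x).

Lemma multiplier_cst c : multiplier (fun=> c).
Proof.
split; first exact: mbounded_cst.
move=> f [fi f0]; split; first exact/integrable_mbounded/fi/mbounded_cst.
move=> xi b; under eq_Rintegral do rewrite mulrCA.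
by rewrite RintegralZl ?f0 ?mulr0//; exact/integrable_mbounded/fi/mbounded_wave.
Qed.

Lemma multiplierM m1 m2 : multiplier m1 -> multiplier m2 ->
  multiplier (fun x => m1 x * m2 x).
Proof.
move=> [bm1 m1P] [bm2 m2P]; split; first exact: mboundedM.
by move=> f /m2P/m1P; under [X in fourier_null X]eq_fun do rewrite mulrA.
Qed.

Lemma multiplierD m1 m2 : multiplier m1 -> multiplier m2 ->
  multiplier (fun x => m1 x + m2 x).
Proof.
move=> [bm1 m1P] [bm2 m2P]; split; first exact: mboundedD.
move=> f nf; have [i1 f1] := m1P _ nf; have [i2 f2] := m2P _ nf; split.
  by apply: integrable_mbounded; [exact: mboundedD|case: nf].
move=> xi b; under eq_Rintegral do rewrite mulrDl mulrDr.
rewrite RintegralD// ?f1 ?f2 ?addr0//.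
  exact/integrable_mbounded/i1/mbounded_wave.
exact/integrable_mbounded/i2/mbounded_wave.
Qed.

Lemma multiplier_cvg (m_ : nat -> rV -> R) (m : rV -> R) (C : R) :
  (forall n, multiplier (m_ n)) -> (forall n x, `|m_ n x| <= C) ->
  (forall x, m_ n x @[n --> \oo] --> m x) -> multiplier m.
Proof.
move=> m_P mC m_m; have bm_ n := (m_P n).1.
have bm := mbounded_cvg bm_ mC m_m.
split=> // f [fi f0]; split; first exact: integrable_mbounded.
move=> xi b; have wfi := integrable_mbounded (mbounded_wave xi b) fi.
under eq_Rintegral do rewrite mulrCA.
have := Rintegral_cvg wfi bm_ mC m_m.
rewrite (_ : (fun n => _) = cst 0); last first.
  apply/funext => n; under eq_Rintegral do rewrite mulrCA.
  by have [_ /(_ f)[]] := m_P n.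
by move=> /(cvg_unique _ (cvg_cst _)) <-.
Qed.

(** A product of two cosines is a sum of cosines. *)
Lemma multiplier_wave xi b : multiplier (wave xi b).
Proof.
split; first exact: mbounded_wave.
move=> f [fi f0]; split; first exact/integrable_mbounded/fi/mbounded_wave.
move=> eta c.
have waveM x : wave eta c x * (wave xi b x * f x) =
    2^-1 * (wave (eta + xi) (c + b) x * f x + wave (eta - xi) (c - b) x * f x).
  rewrite /wave !rVdotDl rVdotNl.
  set p := rVdot eta x + c; set q := rVdot xi x + b.
  rewrite (_ : _ + _ + (c + b) = p + q); last by rewrite /p /q; ring.
  rewrite (_ : _ - _ + (c - b) = p - q); last by rewrite /p /q; ring.
  by rewrite cosD cosB; field.
under eq_Rintegral do rewrite waveM.
have wfi eta' b' := integrable_mbounded (mbounded_wave eta' b') fi.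
rewrite RintegralZl//; last exact: integrable_addr.
by rewrite RintegralD// !f0 addr0 mulr0.
Qed.

(* y (3 - y^2) / 2: an odd polynomial map of [-1, 1] to itself that fixes -1, 0
   and 1 and pushes the other points towards the ends, so that its iterates
   converge to the sign function at every point. *)
Let sharpen (y : R) : R := y * (2^-1 * (3 + (- 1) * (y * y))).

Let sharpenN y : sharpen (- y) = - sharpen y.
Proof. by rewrite /sharpen; ring. Qed.

Let iter_sharpen y n : 0 <= y <= 1 ->
  y <= iter n sharpen y <= 1 /\ 1 - iter n sharpen y <= (1 - y / 2) ^+ n.
Proof.
move=> /andP[y0 y1]; elim: n => [|n [/andP[ys s1] sn]] /=.
  by rewrite lexx y1 expr0 lerBlDr lerDl.
set s := iter n sharpen y in ys s1 sn *.
have shE : 1 - sharpen s = (1 - s) * (1 - s / 2 - s * s / 2).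
  by rewrite /sharpen; field.
have s0 : 0 <= s by lra.
split.
  apply/andP; split.
    rewrite (le_trans ys)// -subr_ge0.
    have -> : sharpen s - s = s * (1 - s) * (1 + s) / 2.
      by rewrite /sharpen; field.
    by rewrite !mulr_ge0//; lra.
  rewrite -subr_ge0 shE.
  have -> : 1 - s / 2 - s * s / 2 = (1 - s) * (2 + s) / 2 by field.
  by rewrite !mulr_ge0//; lra.
rewrite shE exprS mulrC.
have ss0 : 0 <= s * s by rewrite mulr_ge0.
have [h|h] := leP 0 (1 - s / 2 - s * s / 2); last first.
  rewrite (@le_trans _ _ 0)//; first by apply: mulr_le0_ge0; lra.
  by rewrite mulr_ge0 ?exprn_ge0//; lra.
by apply: ler_pM => //; lra.
Qed.

Let cvg_sharpen y : `|y| <= 1 -> iter n sharpen y @[n --> \oo] --> Num.sg y.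
Proof.
have pos x : 0 < x -> x <= 1 -> iter n sharpen x @[n --> \oo] --> (1 : R).
  move=> x0 x1; have x01 : 0 <= x <= 1 by rewrite ltW.
  apply: (@squeeze_cvgr _ _ _ _ (fun n => 1 - (1 - x / 2) ^+ n) (cst 1)).
  - by apply: nearW => n; have [/andP[_ ->] +] := iter_sharpen n x01; lra.
  - rewrite -[X in _ --> X]subr0; apply: cvgB; first exact: cvg_cst.
    by apply: cvg_expr; rewrite ltr_norml; lra.
  - exact: cvg_cst.
move=> y1; have [y0|y0|y0] := ltgtP y 0.
- rewrite ltr0_sg// -[y]opprK.
  rewrite (_ : (fun n => _) = (fun n => - iter n sharpen (- y))).
    apply: cvgN; apply: pos; first by rewrite oppr_gt0.
    by rewrite -(ltr0_norm y0).
  by apply/funext; elim=> [//|n /= ->]; rewrite sharpenN.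
- by rewrite gtr0_sg//; apply: pos => //; rewrite -(gtr0_norm y0).
- rewrite y0 sgr0 (_ : (fun n => _) = cst 0); first exact: cvg_cst.
  by apply/funext; elim=> [//|n /= ->]; rewrite /sharpen mul0r.
Qed.

Lemma sg_le1 (y : R) : `|Num.sg y| <= 1.
Proof. by rewrite normr_sg; case: eqP. Qed.

(** The iterates above, taken at a wave, are polynomials in this wave. *)
Lemma multiplier_sg_wave xi b : multiplier (fun x => Num.sg (wave xi b x)).
Proof.
apply: (@multiplier_cvg (fun n x => iter n sharpen (wave xi b x)) _ 1).
- elim=> [|n IH] /=; first exact: multiplier_wave.
  apply: multiplierM => //; apply: multiplierM; first exact: multiplier_cst.
  apply: multiplierD; first exact: multiplier_cst.
  apply: multiplierM; first exact: multiplier_cst.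
  exact: multiplierM.
- move=> n x.
  have pos y : 0 <= y <= 1 -> `|iter n sharpen y| <= 1.
    move=> y01; have [/andP[ys ys1] _] := iter_sharpen n y01.
    by rewrite ger0_norm//; case/andP: y01 => y0 _; exact: le_trans ys.
  have /andP[] : -1 <= wave xi b x <= 1 by rewrite -ler_norml; exact: cos_max.
  set y := wave xi b x => yl yu.
  have [y0|/ltW y0] := leP 0 y; first by apply: pos; rewrite y0.
  rewrite -normrN (_ : - _ = iter n sharpen (- y)).
    by apply: pos; lra.
  by elim: (n) => [//|k /= <-]; rewrite sharpenN.
- by move=> x; apply: cvg_sharpen; exact: cos_max.
Qed.

(** The sign of sin (y / n) is that of y as soon as n > |y|. *)
Lemma multiplier_sg_coord i c : multiplier (fun x => Num.sg (x ord0 i - c)).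
Proof.
pose w n (x : rV) : R := wave (n.+1%:R^-1 *: delta_mx ord0 i)
  (- (n.+1%:R^-1 * c) - pi / 2) x.
apply: (@multiplier_cvg (fun n x => Num.sg (w n x)) _ 1).
- by move=> n; exact: multiplier_sg_wave.
- by move=> n x; exact: sg_le1.
move=> x; apply: cvg_near_cst; near=> n.
have -> : w n x = sin ((x ord0 i - c) / n.+1%:R).
  rewrite /w /wave rVdotZl rVdot_delta addrA cosBpihalf; congr sin.
  by ring.
set y := x ord0 i - c.
have small : `|y| < n.+1%:R.
  near: n; exists (Num.truncn `|y|) => // n /= yn.
  by rewrite (lt_le_trans (truncnS_gt _))// ler_nat ltnS.
have {}small : `|y / n.+1%:R| < 1.
  by rewrite normrM normfV [`|n.+1%:R|]ger0_norm// ltr_pdivrMr ?ltr0n// mul1r.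
have n0 : (0 : R) < n.+1%:R^-1 by rewrite invr_gt0.
have [y0|y0|->] := ltgtP y 0; last by rewrite mul0r sin0.
- have : y / n.+1%:R < 0 by rewrite pmulr_llt0.
  move: (y / _) small => z z1 z0; rewrite (ltr0_sg y0) ltr0_sg//.
  rewrite -oppr_gt0 -sinN sin2_gt0//.
  by move: z1; rewrite ltr0_norm//; lra.
- have : 0 < y / n.+1%:R by rewrite pmulr_lgt0.
  move: (y / _) small => z z1 z0; rewrite (gtr0_sg y0) gtr0_sg// sin2_gt0//.
  by move: z1; rewrite gtr0_norm//; lra.
Unshelve. all: by end_near. Qed.

(** The sets with this property form a sigma-algebra containing all half-spaces
    orthogonal to the axes. *)
Lemma multiplier_indic (B : set rV) : measurable B -> multiplier \1_B.
Proof.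
pose D : set (set rV) := [set B | multiplier \1_B].
have DC A : D A -> D (~` A).
  move=> DA; rewrite /D/=.
  rewrite (_ : \1__ = fun x => 1 + (-1) * \1_A x :> R).
    apply: multiplierD; first exact: multiplier_cst.
    by apply: multiplierM => //; exact: multiplier_cst.
  apply/funext => x; rewrite indicC indicE; case: (x \in A).
    by rewrite mulr1 subrr.
  by rewrite mulr0 addr0.
have DI A B' : D A -> D B' -> D (A `&` B').
  by move=> DA DB; rewrite /D/= indicI; exact: multiplierM.
have DU A B' : D A -> D B' -> D (A `|` B').
  by move=> DA DB; rewrite -[_ `|` _]setCK setCU; apply/DC/DI; exact: DC.
have D0 : D set0 by rewrite /D/= indic0; exact: multiplier_cst.
have Dbig (F : nat -> set rV) : (forall n, D (F n)) -> D (\bigcup_n F n).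
  move=> DF; rewrite /D/=.
  apply: (@multiplier_cvg (fun n => \1_(\big[setU/set0]_(i < n) F i)) _ 1).
  - by move=> n; rewrite -[multiplier _]/(D _); elim/big_ind : _.
  - by move=> n x; rewrite indicE; case: (_ \in _); rewrite ?normr1 ?normr0.
  - move=> x; apply: cvg_near_cst.
    have [[N _ FNx]|nFx] := pselect ((\bigcup_n F n) x).
      exists N.+1 => // n /= Nn; rewrite !indicE !mem_set//.
        by exists N.
      by rewrite -bigcup_mkord; exists N.
    apply: nearW => n; rewrite !indicE !memNset// -bigcup_mkord => -[k _ Fk].
    by apply: nFx; exists k.
suff : g_sigma_preimage
    (fun i (x : rV) => x ord0 i : measurableTypeR R) `<=` D.
  exact.
apply: smallest_sub.
  split=> // A DA; rewrite setTD; exact: DC.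
rewrite -bigcup_seq; apply: bigcup_sub => i _ _ [Y mY <-]; rewrite setTI.
have : (@measurable _ (measurableTypeR R)) `<=`
    [set Y : set R | D ((fun x : rV => x ord0 i) @^-1` Y)].
  rewrite RGenOInfty.measurableE; apply: smallest_sub.
    split => //=.
    - by move=> A DA; rewrite setTD preimage_setC; exact: DC.
    - by move=> F DF; rewrite preimage_bigcup; exact: Dbig.
  move=> _ [c ->]; rewrite /D/=.
  pose s (x : rV) : R := Num.sg (x ord0 i - c).
  have sP : multiplier s by exact: multiplier_sg_coord.
  rewrite (_ : \1__ = fun x => 2^-1 * (s x * s x + s x) :> R).
    apply: multiplierM; first exact: multiplier_cst.
    by apply: multiplierD => //; exact: multiplierM.
  apply/funext => x; rewrite indicE /s.
  have [h|h|h] := ltgtP c (x ord0 i).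
  - by rewrite mem_set/= ?in_itv/= ?h// gtr0_sg ?subr_gt0//; field.
  - rewrite memNset/= ?in_itv/= ?andbT; last by rewrite ltNge (ltW h).
    by rewrite ltr0_sg ?subr_lt0//; field.
  - rewrite memNset/= ?in_itv/= ?andbT; last by rewrite h ltxx.
    by rewrite h subrr sgr0; field.
by apply.
Qed.

Theorem fourier_null_ae0 (f : rV -> R) : fourier_null f ->
  {ae mu, forall x, f x = 0}.
Proof.
move=> nf; have [fi _] := nf; have mf := measurable_int mu fi.
have {}mf : measurable_fun setT f by exact/measurable_EFinP.
pose s x : R := \1_(f @^-1` `]0, +oo[) x + (-1) * \1_(f @^-1` `]-oo, 0[) x.
have sP : multiplier s.
  apply: multiplierD; last apply: multiplierM; first 1 last.
  - exact: multiplier_cst.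
  - by apply: multiplier_indic; rewrite -[X in measurable X]setTI; exact: mf.
  - by apply: multiplier_indic; rewrite -[X in measurable X]setTI; exact: mf.
have sf x : s x * f x = `|f x|.
  rewrite /s !indicE; have [h|h|h] := ltgtP 0 (f x).
  - rewrite mem_set/= ?in_itv/= ?h// memNset/= ?in_itv/=; last first.
      by rewrite ltNge (ltW h).
    by rewrite gtr0_norm//; ring.
  - rewrite memNset/= ?in_itv/= ?andbT; last by rewrite ltNge (ltW h).
    by rewrite mem_set/= ?in_itv/= ?h// ltr0_norm//; ring.
  - by rewrite -h mulr0 normr0.
have [_ /(_ _ nf)[_ /(_ 0 0)]] := sP.
under eq_Rintegral do rewrite sf /wave rVdot0l addr0 cos0 mul1r.
move=> int0.
have : ae_eq mu setT (EFin \o f) (cst 0%E).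
  apply/(ae_eq_integral_abs _ measurableT); first exact: (measurable_int mu).
  rewrite -[LHS]fineK; first by congr EFin.
  exact: integrable_fin_num (integrable_abse fi).
by apply: filterS => x /(_ Logic.I)[].
Qed.

End fourier_uniqueness.

(** * Smooth functions on the line with bounded derivatives *)

Section bounded_smooth.
Variable R : realType.

(** The bounds are required globally: these functions are the profiles of
    functions x |-> g (<xi, x> + b), whose values sweep the whole line. *)
Fixpoint bsmooth (n : nat) (g : R -> R) : Prop :=
  [/\ forall t, derivable g t 1, exists C : R, forall t, `|g t| <= C &
      if n is n'.+1 then bsmooth n' g^`()%classic else True].

Let cos_shift (b t : R) :
  is_derive t (1 : R) (fun t => cos (t + b)) (cos (t + (b + pi / 2))).
Proof.
have dD : is_derive t (1 : R) (fun t : R => t + b) 1.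
  by apply: trigger_derive; rewrite addr0.
have := @is_derive1_comp R cos ( +%R^~ b) t _ _ (is_derive_cos (t + b)) dD.
by rewrite mulr1 addrA cosDpihalf.
Qed.

Lemma bsmooth_cos n b : bsmooth n (fun t => cos (t + b)).
Proof.
have cosC c : exists C : R, forall t : R, `|cos (t + c)| <= C.
  by exists 1 => t; exact: cos_max.
have der c t : derivable (fun t : R => cos (t + c)) t 1.
  by have [] := cos_shift c t.
elim: n b => [|n IH] b /=; split=> //.
rewrite (_ : _^`()%classic = fun t => cos (t + (b + pi / 2)))//.
by apply/funext => t; rewrite derive1E; have := cos_shift b t => -[].
Qed.

(** Each monomial y^i is at most i! exp y. *)
Lemma poly_expRN_bounded (p : {poly R}) :
  exists C : R, forall y, 0 <= y -> `|p.[y] * expR (- y)| <= C.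
Proof.
exists (\sum_(i < size p) `|p`_i| * i`!%:R) => y y0.
rewrite horner_coef mulr_suml (le_trans (ler_norm_sum _ _ _))//.
apply: ler_sum => i _; rewrite -mulrA normrM ler_wpM2l//.
rewrite ger0_norm ?mulr_ge0 ?exprn_ge0 ?expR_ge0//.
rewrite expRN ler_pdivrMr ?expR_gt0// -ler_pdivrMl ?ltr0n ?fact_gt0//.
case: i => -[|i] /= _.
  by rewrite fact0 invr1 mul1r expr0 -expR0 ler_expR.
by rewrite mulrC; have := expR_ge1Dxn i y0; lra.
Qed.

(** The family of the functions p(1/t) exp(-1/t), extended by 0 to t <= 0, is
    stable under differentiation, which replaces p by X^2 (p - p'). All its
    members are therefore smooth and bounded with all their derivatives. *)
Definition flat (p : {poly R}) (t : R) : R :=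
  if 0 < t then p.[t^-1] * expR (- t^-1) else 0.

Let dflat (p : {poly R}) : {poly R} := 'X^2 * (p - p^`()).

Lemma flat_bounded p : exists C : R, forall t, `|flat p t| <= C.
Proof.
have [C HC] := poly_expRN_bounded p; exists `|C| => t; rewrite /flat.
case: ifPn => t0; last by rewrite normr0.
by rewrite (le_trans (HC _ _)) ?ler_norm// invr_ge0 ltW.
Qed.

Lemma is_derive_flat p t : is_derive t (1 : R) (flat p) (flat (dflat p) t).
Proof.
have [t0|t0|->] := ltgtP t 0.
- apply: (@near_eq_is_derive _ _ _ (cst 0)).
    near=> s; have s0 : s < 0 by near: s; exact: lt_nbhsl.
    by rewrite /flat ltNge (ltW s0).
  by rewrite /flat ltNge (ltW t0); exact: is_derive_cst.
- pose f y : R := p.[y] * expR (- y).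
  apply: (@near_eq_is_derive _ _ _ (f \o GRing.inv)).
    near=> s; have s0 : 0 < s by near: s; exact: lt_nbhsr.
    by rewrite /flat s0.
  have tN0 : t != 0 by rewrite gt_eqF.
  have dV : is_derive t (1 : R) GRing.inv (- t ^- 2).
    have dI : is_derive t (1 : R) id 1 by exact: is_derive_id.
    have := @is_deriveV R id t 1 1 tN0 dI.
    by rewrite [_ *: _]mulr1.
  have dN : is_derive t^-1 (1 : R) (fun y : R => expR (- y)) (- expR (- t^-1)).
    have dN : is_derive t^-1 (1 : R) (fun y : R => - y) (- 1).
      exact: is_deriveN.
    have := @is_derive1_comp R expR -%R t^-1 _ _ (is_derive_expR (- t^-1)) dN.
    by rewrite mulrN1.
  have df := is_deriveM (is_derive_poly p t^-1) dN.
  have := @is_derive1_comp R _ GRing.inv t _ _ df dV.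
  rewrite /flat t0 /dflat !hornerE => h; apply: (is_derive_eq h).
  rewrite (_ : p.[_] *: _ = p.[t^-1] * - expR (- t^-1))//.
  rewrite (_ : expR _ *: _ = expR (- t^-1) * p^`().[t^-1])//.
  by field.
(* With y = 1 / h, the difference quotient at h > 0 is h times the bounded
   quantity y^2 p(y) exp(-y). *)
- have [C HC] := poly_expRN_bounded ('X^2 * p).
  have f0 q : flat q 0 = 0 by rewrite /flat ltxx.
  have lim0 : (fun h => h^-1 *: ((flat p \o shift 0) (h *: (1 : R)) - flat p 0))
      @ 0^' --> (0 : R).
    apply/cvgr0Pnorm_le => eps eps0; near=> h.
    have C1 : 0 < `|C| + 1 by rewrite ltr_wpDl.
    have hC : `|h| < eps / (`|C| + 1).
      by near: h; apply: dnbhs0_lt; rewrite divr_gt0.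
    rewrite /= f0 subr0 addr0 [h *: 1]mulr1.
    rewrite (_ : _ *: _ = h^-1 * flat p h)// /flat.
    case: ifPn => h0; last by rewrite mulr0 normr0 ltW.
    have y0 : 0 <= h^-1 by rewrite invr_ge0 ltW.
    have -> : h^-1 * (p.[h^-1] * expR (- h^-1)) =
        h * (('X^2 * p).[h^-1] * expR (- h^-1)).
      rewrite hornerM hornerXn; move: (p.[_]) (expR _) => a b.
      by field; rewrite gt_eqF.
    rewrite normrM (le_trans (ler_wpM2l _ (HC _ y0)))//.
    rewrite (le_trans (ler_wpM2l _ (ler_norm C)))//.
    rewrite (@le_trans _ _ (`|h| * (`|C| + 1)))//.
      by rewrite ler_wpM2l// lerDl.
    by rewrite -ler_pdivlMr// ltW.
  apply: DeriveDef; first by apply/cvg_ex; exists 0.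
  by rewrite f0; exact: cvg_lim lim0.
Unshelve. all: by end_near. Qed.

Lemma bsmooth_flat n p : bsmooth n (flat p).
Proof.
have der q t : derivable (flat q) t 1 by have [] := is_derive_flat q t.
elim: n p => [|n IH] p /=; split=> //; try exact: flat_bounded.
rewrite (_ : _^`()%classic = flat (dflat p))//.
by apply/funext => t; rewrite derive1E; have := is_derive_flat p t => -[].
Qed.

End bounded_smooth.

(** * Convergence with bounds on all derivatives *)

Section approximation.
Variables (R : realType) (d : nat).
Local Notation rV := 'rV[R]_d.
Local Notation e i := (delta_mx ord0 i : rV).

Definition bdd_cvg (F : nat -> rV -> R) (f : rV -> R) : Prop :=
  [/\ forall N, [/\ measurable_fun setT (F N), continuous (F N) &
        forall i x, derivable (F N) x (e i)],
      forall i x, derivable f x (e i),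
      exists C : R, forall N x, `|F N x| <= C &
      forall x, F N x @[N --> \oo] --> f x].

(** The recursion passes to the first derivatives, so that stability under
    products follows by induction from the Leibniz rule of order one, without
    the general formula. *)
Fixpoint Cn_cvg (n : nat) (F : nat -> rV -> R) (f : rV -> R) : Prop :=
  bdd_cvg F f /\
  if n is n'.+1 then
    forall i, Cn_cvg n' (fun N => partial i (F N)) (partial i f)
  else True.

Lemma Cn_cvg_bdd n F f : Cn_cvg n F f -> bdd_cvg F f.
Proof. by case: n => [|n] []. Qed.

Lemma Cn_cvgW n F f : Cn_cvg n.+1 F f -> Cn_cvg n F f.
Proof.
elim: n F f => [|n IH] F f; first by case.
by move=> [Ff dFf]; split=> // i; exact/IH/dFf.
Qed.

(** The first derivative taken is the last entry of the list, hence the view of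
    the list from its end. *)
Lemma Cn_cvg_iter n (s : seq 'I_d) F f : (size s <= n)%N -> Cn_cvg n F f ->
  bdd_cvg (fun N => iter_partial s (F N)) (iter_partial s f).
Proof.
elim: n s F f => [|n IH] s F f.
  by rewrite leqn0 size_eq0 => /eqP ->; exact: Cn_cvg_bdd.
case/lastP: s => [_|s i]; first exact: Cn_cvg_bdd.
rewrite size_rcons ltnS => sn [_ /(_ i) dFf].
have := IH s _ _ sn dFf.
rewrite /iter_partial foldr_rcons.
by under [X in bdd_cvg X _ -> _]eq_fun do rewrite -foldr_rcons.
Qed.

Lemma bdd_cvg_cst (c_ : nat -> R) (c : R) : c_ n @[n --> \oo] --> c ->
  bdd_cvg (fun n _ => c_ n) (fun=> c).
Proof.
move=> c_c; split.
- move=> N; split; first exact: measurable_cst.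
    exact: cst_continuous.
  by move=> i x; exact: derivable_cst.
- by move=> i x; exact: derivable_cst.
- have /cvg_seq_bounded[M [_ HM]] : cvgn c_ by apply/cvg_ex; exists c.
  by exists (M + 1) => N x; apply: HM => //; rewrite ltrDl.
- by move=> x.
Qed.

Lemma partial_cst i (c : R) : partial i (fun _ : rV => c) = fun=> 0.
Proof. by apply/funext => x; exact: derive_cst. Qed.

Lemma Cn_cvg_cst n (c_ : nat -> R) (c : R) : c_ N @[N --> \oo] --> c ->
  Cn_cvg n (fun N _ => c_ N) (fun=> c).
Proof.
elim: n c_ c => [|n IH] c_ c c_c; split=> //; try exact: bdd_cvg_cst.
move=> i; rewrite partial_cst.
rewrite (_ : (fun N => _) = fun (_ : nat) (_ : rV) => 0).
  by apply: IH; exact: cvg_cst.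
by apply/funext => N; rewrite partial_cst.
Qed.

Lemma bdd_cvgD F f G g : bdd_cvg F f -> bdd_cvg G g ->
  bdd_cvg (fun N x => F N x + G N x) (fun x => f x + g x).
Proof.
move=> [F1 f1 [C FC] F2] [G1 g1 [D GD] G2]; split.
- move=> N; have [mF cF dF] := F1 N; have [mG cG dG] := G1 N; split.
  + exact: measurable_funD.
  + by move=> x; exact: (cvgD (cF x) (cG x)).
  + by move=> i x; exact: (derivableD (dF i x) (dG i x)).
- by move=> i x; exact: (derivableD (f1 i x) (g1 i x)).
- by exists (C + D) => N x; rewrite (le_trans (ler_normD _ _))// lerD.
- by move=> x; exact: (cvgD (F2 x) (G2 x)).
Qed.

Lemma bdd_cvgM F f G g : bdd_cvg F f -> bdd_cvg G g ->
  bdd_cvg (fun N x => F N x * G N x) (fun x => f x * g x).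
Proof.
move=> [F1 f1 [C FC] F2] [G1 g1 [D GD] G2]; split.
- move=> N; have [mF cF dF] := F1 N; have [mG cG dG] := G1 N; split.
  + exact: measurable_funM.
  + by move=> x; exact: (cvgM (cF x) (cG x)).
  + by move=> i x; exact: (derivableM (dF i x) (dG i x)).
- by move=> i x; exact: (derivableM (f1 i x) (g1 i x)).
- by exists (C * D) => N x; rewrite normrM ler_pM.
- by move=> x; exact: (cvgM (F2 x) (G2 x)).
Qed.

Lemma partialD i (f g : rV -> R) : (forall x, derivable f x (e i)) ->
  (forall x, derivable g x (e i)) ->
  partial i (fun x => f x + g x) = fun x => partial i f x + partial i g x.
Proof. by move=> df dg; apply/funext => x; exact: (deriveD (df x) (dg x)). Qed.

Lemma partialM i (f g : rV -> R) : (forall x, derivable f x (e i)) ->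
  (forall x, derivable g x (e i)) ->
  partial i (fun x => f x * g x) =
  fun x => f x * partial i g x + partial i f x * g x.
Proof.
move=> df dg; apply/funext => x.
rewrite [partial i f x * _]mulrC.
exact: (deriveM (df x) (dg x)).
Qed.

Lemma Cn_cvgD n F f G g : Cn_cvg n F f -> Cn_cvg n G g ->
  Cn_cvg n (fun N x => F N x + G N x) (fun x => f x + g x).
Proof.
elim: n F f G g => [|n IH] F f G g [Ff dFf] [Gg dGg].
  by split=> //; exact: bdd_cvgD.
split; first exact: bdd_cvgD.
have [F1 f1 _ _] := Ff; have [G1 g1 _ _] := Gg.
move=> i; have := IH _ _ _ _ (dFf i) (dGg i).
rewrite partialD//; congr Cn_cvg; apply/funext => N; rewrite partialD//.
  by have [_ _] := F1 N; apply.
by have [_ _] := G1 N; apply.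
Qed.

Lemma Cn_cvgM n F f G g : Cn_cvg n F f -> Cn_cvg n G g ->
  Cn_cvg n (fun N x => F N x * G N x) (fun x => f x * g x).
Proof.
elim: n F f G g => [|n IH] F f G g HF HG.
  by split=> //; apply: bdd_cvgM; [exact: Cn_cvg_bdd HF|exact: Cn_cvg_bdd HG].
have [Ff dFf] := HF; have [Gg dGg] := HG.
split; first exact: bdd_cvgM.
have [F1 f1 _ _] := Ff; have [G1 g1 _ _] := Gg.
move=> i; have := Cn_cvgD (IH _ _ _ _ (Cn_cvgW HF) (dGg i))
  (IH _ _ _ _ (dFf i) (Cn_cvgW HG)).
rewrite partialM//; congr Cn_cvg; apply/funext => N; rewrite partialM//.
  by have [_ _] := F1 N; apply.
by have [_ _] := G1 N; apply.
Qed.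

Lemma Cn_cvg_prod n (I : Type) (s : seq I) (F : I -> nat -> rV -> R)
    (f : I -> rV -> R) : (forall i, Cn_cvg n (F i) (f i)) ->
  Cn_cvg n (fun N x => \prod_(i <- s) F i N x) (fun x => \prod_(i <- s) f i x).
Proof.
move=> Ff; elim: s => [|i s IH].
  under eq_fun do under eq_fun do rewrite big_nil.
  under [X in Cn_cvg n _ X]eq_fun do rewrite big_nil.
  by apply: (@Cn_cvg_cst n (fun=> 1)); exact: cvg_cst.
under eq_fun do under eq_fun do rewrite big_cons.
under [X in Cn_cvg n _ X]eq_fun do rewrite big_cons.
exact: Cn_cvgM.
Qed.

(** Moving x by h along the i-th axis moves <xi, x> by h xi_i: the partial
    derivative of g (<xi, x> + b) is the derivative of g along xi_i. *)
Lemma ridge_quotient (g : R -> R) (xi : rV) (b : R) i x :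
  (fun h : R => h^-1 *:
     (((fun y => g (rVdot xi y + b)) \o shift x) (h *: e i)
      - g (rVdot xi x + b))) =
  (fun h : R => h^-1 *:
     ((g \o shift (rVdot xi x + b)) (h *: xi ord0 i) - g (rVdot xi x + b))).
Proof.
apply/funext => h /=; congr (_ *: (g _ - _)).
by rewrite addrA rVdotC rVdotDl rVdotZl rVdot_delta rVdotC.
Qed.

Lemma derivable_ridge (g : R -> R) (xi : rV) (b : R) i x :
  (forall t, derivable g t 1) ->
  derivable (fun y => g (rVdot xi y + b)) x (e i).
Proof.
move=> dg; rewrite /derivable ridge_quotient.
by apply: diff_derivable; exact/derivable1_diffP.
Qed.

Lemma partial_ridge (g : R -> R) (xi : rV) (b : R) i :
  (forall t, derivable g t 1) ->
  partial i (fun y => g (rVdot xi y + b)) =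
  fun x => xi ord0 i * g^`()%classic (rVdot xi x + b).
Proof.
move=> dg; apply/funext => x; rewrite /partial /derive ridge_quotient.
rewrite -[LHS]/('D_(xi ord0 i) g (rVdot xi x + b)).
have dfg : differentiable g (rVdot xi x + b) by exact/derivable1_diffP.
rewrite derive1E' // deriveE// -{1}[xi ord0 i]mulr1.
exact: linearZ.
Qed.

(** A partial derivative of a ridge function is a constant times the ridge
    function of the derived profile; with varying xi, these constants form a
    convergent sequence. *)
Lemma Cn_cvg_ridge n (g : R -> R) (xi_ : nat -> rV) (xi : rV) (b : R) :
  bsmooth n g ->
  (forall i, xi_ N ord0 i @[N --> \oo] --> xi ord0 i) ->
  Cn_cvg n (fun N x => g (rVdot (xi_ N) x + b)) (fun x => g (rVdot xi x + b)).
Proof.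
move=> gs xi_xi.
have rVdot_cvg x : rVdot (xi_ N) x @[N --> \oo] --> rVdot xi x.
  apply: cvg_big => [|i _]; first exact: add_continuous.
  by apply: cvgMr_tmp; exact: xi_xi.
have rVdot_cont (eta : rV) : continuous (fun x => rVdot eta x + b).
  have eta_cont : continuous (rVdot eta).
    apply: continuous_big => [|i _ x]; first exact: add_continuous.
    exact: (cvgMl_tmp (@coord_continuous R _ _ ord0 i x)).
  by move=> x; exact: (cvgD (eta_cont x) (cvg_cst b)).
have bdd (h : R -> R) :
    (forall t, derivable h t 1) -> (exists C : R, forall t, `|h t| <= C) ->
    bdd_cvg (fun N x => h (rVdot (xi_ N) x + b)) (fun x => h (rVdot xi x + b)).
  move=> dh [C hC].
  have ch : continuous h.
    by move=> t; exact/differentiable_continuous/derivable1_diffP.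
  split.
  - move=> N; split.
    + apply: (measurableT_comp (f := h)).
        exact: continuous_measurable_fun.
      apply: measurable_funD; last exact: measurable_cst.
      exact: measurable_rVdot.
    + move=> x.
      apply: (@continuous_comp _ _ _ (fun x => rVdot (xi_ N) x + b) h).
        exact: rVdot_cont.
      exact: ch.
    + by move=> i x; exact: derivable_ridge.
  - by move=> i x; exact: derivable_ridge.
  - by exists C => N x; exact: hC.
  - move=> x; apply: continuous_cvg; first exact: ch.
    exact: (cvgD (rVdot_cvg x) (cvg_cst b)).
elim: n g gs => [|n IH] g [dg gC gs]; split=> //; try exact: bdd.
move=> i; rewrite partial_ridge//.
under eq_fun do rewrite partial_ridge//.
by apply: Cn_cvgM; [exact: Cn_cvg_cst|exact: IH].
Qed.

End approximation.

(** * Truncated plane waves *)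

Section truncated_waves.
Variables (R : realType) (d : nat).
Local Notation rV := 'rV[R]_d.
Local Notation e i := (delta_mx ord0 i : rV).

(** Each derivative of the cosine shifts its phase by pi / 2. *)
Lemma iter_partial_wave (s : seq 'I_d) (xi : rV) (b : R) :
  iter_partial s (wave xi b) = fun x =>
    (\prod_(i <- s) xi ord0 i) * wave xi (b + (size s)%:R * (pi / 2)) x.
Proof.
elim: s => [|i s IH].
  by apply/funext => x; rewrite big_nil mul1r mul0r addr0.
rewrite [LHS]/= -/(iter_partial s _) IH.
set c := \prod_(j <- s) _; set b' := b + _.
pose g (t : R) := c * cos t.
have dg t : is_derive t (1 : R) g (c * - sin t).
  by apply: trigger_derive; rewrite [_ *: _]/(c * - sin t).
rewrite (_ : (fun x => _) = (fun x => g (rVdot xi x + b')))//.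
rewrite partial_ridge; last by move=> t; have [] := dg t.
apply/funext => x; rewrite derive1E; have [_ ->] := dg (rVdot xi x + b').
rewrite big_cons /wave -cosDpihalf mulrA; congr (_ * cos _).
by rewrite /b' /= -natr1; ring.
Qed.

(** The N-th cutoff is supported in the cube of half-side N + 1. Written as a
    product of ridge functions whose frequencies tend to 0, it converges with
    bounds on all derivatives to its value 1 at the origin; the factor exp 1 is
    the normalisation that makes this value 1. *)
Definition cutoff (N : nat) (x : rV) : R := \prod_(i < d)
  (flat (expR 1)%:P (rVdot (- N.+1%:R^-1 *: e i) x + 1) *
   flat (expR 1)%:P (rVdot (N.+1%:R^-1 *: e i) x + 1)).

Definition truncated_wave (xi : rV) (b : R) (N : nat) (x : rV) : R :=
  wave xi b x * cutoff N x.

Lemma truncated_wave_cvg n xi b :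
  Cn_cvg n (truncated_wave xi b) (wave xi b).
Proof.
have flat1 : flat (expR 1)%:P (1 : R) = 1.
  by rewrite /flat ltr01 hornerC invr1 -expRD subrr expR0.
have e_cvg (c : R) i : forall j,
    (N.+1%:R^-1 *: (c *: e i)) ord0 j @[N --> \oo] --> (0 : rV) ord0 j.
  move=> j; have -> : (0 : rV) ord0 j = 0 * (c *: e i) ord0 j.
    by rewrite mxE mul0r.
  under eq_cvg do rewrite mxE.
  exact: (cvgMr_tmp cvg_harmonic).
rewrite [X in Cn_cvg n _ X](_ : _ = fun x => wave xi b x * \prod_(i < d)
    (flat (expR 1)%:P (rVdot 0 x + 1) *
     flat (expR 1)%:P (rVdot 0 x + 1))); last first.
  apply/funext => x; rewrite big1 ?mulr1// => i _.
  by rewrite rVdot0l add0r flat1 mulr1.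
apply: Cn_cvgM.
  apply: (@Cn_cvg_ridge _ _ _ cos (fun=> xi)) => [|i]; last exact: cvg_cst.
  have := bsmooth_cos n (0 : R).
  by under [X in bsmooth n X -> _]eq_fun do rewrite addr0.
apply: Cn_cvg_prod => i; apply: Cn_cvgM; apply: Cn_cvg_ridge => [|j].
- exact: bsmooth_flat.
- have := e_cvg (-1) i j; under eq_cvg do rewrite scaleN1r scalerN -scaleNr.
  exact.
- exact: bsmooth_flat.
- have := e_cvg 1 i j; under eq_cvg do rewrite scale1r.
  exact.
Qed.

Lemma truncated_wave_test xi b N : test_function (truncated_wave xi b N).
Proof.
split.
  move=> s; have tw := truncated_wave_cvg (size s) xi b.
  by have [/(_ N)[]] := Cn_cvg_iter (leqnn _) tw.
pose B := [set x : rV | forall i, `[- N.+1%:R, N.+1%:R]%classic (x ord0 i)].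
have cB : compact B.
  apply: (@rV_compact R d (fun=> `[- N.+1%:R, N.+1%:R]%classic)) => i.
  exact: segment_compact.
apply: (subclosed_compact (@closed_closure _ _) cB).
have clB : closed B by apply: compact_closed => //; exact: norm_hausdorff.
rewrite ((closure_id B).1 clB); apply: closure_subset => x /=.
rewrite mulf_eq0 negb_or => /andP[_] /prodf_neq0 xN i; have := xN i isT.
rewrite mulf_eq0 negb_or !rVdotZl rVdot_delta mulNr (mulrC _^-1) /flat.
move=> /andP[]; have n0 : (0 : R) < N.+1%:R by [].
case: ifPn => [xlt _|_]; last by rewrite eqxx.
case: ifPn => [xgt _|_]; last by rewrite eqxx.
have xle : x ord0 i / N.+1%:R < 1 by rewrite addrC subr_gt0 in xlt.
have xge : - 1 < x ord0 i / N.+1%:R by rewrite -ltrBlDr sub0r in xgt.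
rewrite /= in_itv/=; apply/andP; split; apply: ltW.
  by rewrite -mulN1r -ltr_pdivlMr.
by rewrite -[ltRHS]mul1r -ltr_pdivrMr.
Qed.

End truncated_waves.

Section multi_index_derivatives.
Variables (R : realType) (d k : nat) (alpha : multi_index d k).

Definition mi_seq : seq 'I_d :=
  flatten [seq nseq (mi alpha i) i | i <- enum 'I_d].

Lemma partial_miE (f : 'rV[R]_d -> R) :
  partial_mi alpha f = iter_partial mi_seq f.
Proof.
rewrite /partial_mi /mi_seq /iter_partial.
elim: (enum 'I_d) => [//|i s IH] /=; rewrite foldr_cat -IH.
by elim: (mi alpha i) => [//|n /= ->].
Qed.

Lemma prod_mi_seq (F : 'I_d -> R) :
  \prod_(i <- mi_seq) F i = \prod_(i < d) F i ^+ mi alpha i.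
Proof.
rewrite /mi_seq -[RHS]big_enum/=.
elim: (enum 'I_d) => [|i s IH] /=; first by rewrite !big_nil.
by rewrite big_cat big_cons IH big_nseq -Monoid.iteropE.
Qed.

Lemma size_mi_seq : size mi_seq = k.
Proof.
rewrite -[RHS](eqP (valP alpha)) -big_enum/= /mi_seq.
elim: (enum 'I_d) => [|i s IH] /=; first by rewrite big_nil.
by rewrite size_cat size_nseq IH big_cons.
Qed.

End multi_index_derivatives.

(** * The equation tested against plane waves *)

Section vector_integrals.
Variables (R : realType) (d : nat) (V : vectType R).
Local Notation mu := (lebesgue_rV R d).
Local Notation rV := 'rV[R]_d.
Implicit Types (u v : rV -> V) (g h : rV -> R).

Lemma vcoordD i (x y : V) : vcoord i (x + y) = vcoord i x + vcoord i y.
Proof. exact: linearD. Qed.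

Lemma vcoordZ i (t : R) (x : V) : vcoord i (t *: x) = t * vcoord i x.
Proof. exact: linearZ. Qed.

Lemma vcoord_eq0 (x : V) : (forall i, vcoord i x = 0) -> x = 0.
Proof.
by move=> x0; rewrite (vcoord_sum x) big1// => i _; rewrite x0 scale0r.
Qed.

Lemma vcoord_Vintegral i u : vcoord i (Vintegral u) = \int[mu]_x vcoord i (u x).
Proof.
have basisE (j : 'I_(\dim {:V})) :
    coord (vbasis {:V}) i (vbasis {:V})`_j = (j == i)%:R.
  by rewrite coord_free ?(basis_free (vbasisP _)).
rewrite /Vintegral {1}/vcoord linear_sum (bigD1 i)//= linearZ/= basisE eqxx.
rewrite mulr1 big1 ?addr0// => j ji.
by rewrite linearZ/= basisE (negPf ji) mulr0.
Qed.

Lemma coord_integrableM g u : mbounded g -> coord_integrable u ->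
  coord_integrable (fun x => g x *: u x).
Proof.
move=> bg iu i; under [X in EFin \o X]eq_fun do rewrite vcoordZ.
exact: integrable_mbounded.
Qed.

Lemma VintegralD u v : coord_integrable u -> coord_integrable v ->
  Vintegral (fun x => u x + v x) = Vintegral u + Vintegral v.
Proof.
move=> iu iv; rewrite /Vintegral -big_split/=; apply: eq_bigr => i _.
rewrite -scalerDl -RintegralD//.
by congr (_ *: _); apply: eq_Rintegral => x _; exact: vcoordD.
Qed.

Lemma VintegralZ (t : R) u : coord_integrable u ->
  Vintegral (fun x => t *: u x) = t *: Vintegral u.
Proof.
move=> iu; rewrite /Vintegral scaler_sumr; apply: eq_bigr => i _.
rewrite scalerA -RintegralZl//.
by congr (_ *: _); apply: eq_Rintegral => x _; exact: vcoordZ.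
Qed.

Lemma lfun_Vintegral_cvg (W : vectType R) (l : 'Hom(V, W)) j
    (g_ : nat -> rV -> R) g u (C : R) :
  coord_integrable u ->
  (forall n, mbounded (g_ n)) -> (forall n x, `|g_ n x| <= C) ->
  (forall x, g_ n x @[n --> \oo] --> g x) ->
  vcoord j (l (Vintegral (fun x => g_ n x *: u x))) @[n --> \oo] -->
  vcoord j (l (Vintegral (fun x => g x *: u x))).
Proof.
move=> iu bg_ gC g_g; have bg := mbounded_cvg bg_ gC g_g.
pose lj : 'Hom(V, R^o) :=
  (linfun (coord (vbasis {:W}) j : W -> R^o) \o l)%VF.
have ljE y : lj y = vcoord j (l y) by rewrite comp_lfunE lfunE.
have lE h : mbounded h -> vcoord j (l (Vintegral (fun x => h x *: u x))) =
    \int[mu]_x (h x * lj (u x)).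
  move=> bh; rewrite -ljE (lfun_Vintegral lj (coord_integrableM bh iu)).2.
  by apply: eq_Rintegral => x _; rewrite linearZ.
rewrite lE//; under eq_cvg do rewrite lE//.
by apply: (Rintegral_cvg _ bg_ gC g_g); exact: (lfun_Vintegral lj iu).1.
Qed.

End vector_integrals.

Section wave_integrals.
Variables (R : realType) (d k : nat) (V W : vectType R).
Variable A : pde_operator d k V W.
Local Notation rV := 'rV[R]_d.

Lemma symbol_homog (t : R) (xi : rV) v :
  symbol A (t *: xi) v = t ^+ k *: symbol A xi v.
Proof.
rewrite /symbol !sum_lfunE scaler_sumr; apply: eq_bigr => alpha _.
rewrite !scale_lfunE scalerA; congr (_ *: _).
under eq_bigr do rewrite mxE exprMn.
rewrite big_split/=; congr (_ * _).
by rewrite prodrXr; congr (_ ^+ _); exact/eqP/(valP alpha).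
Qed.

(** Testing the equation against a truncated plane wave and removing the
    truncation, each derivative of order k multiplies the wave by a monomial in
    xi and shifts its phase by k pi / 2: this is the equation for the Fourier
    transform of u. *)
Lemma symbol_wave (u : rV -> V) (xi : rV) (b : R) :
  coord_integrable u -> distr_solution A u ->
  symbol A xi (Vintegral (fun x => wave xi b x *: u x)) = 0.
Proof.
move=> iu Au; apply: vcoord_eq0 => j.
(* The phase that k derivatives bring back to b. *)
pose b0 := b - k%:R * (pi / 2).
pose phi N := truncated_wave xi b0 N.
pose I alpha N : R :=
  vcoord j (A alpha (Vintegral (fun x => partial_mi alpha (phi N) x *: u x))).
have I0 N : \sum_alpha I alpha N = 0.
  have := Au _ (truncated_wave_test xi b0 N).
  rewrite /distr_apply => /(congr1 (vcoord j)).
  rewrite /vcoord linear0 linear_sum/=.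
  under eq_bigr do rewrite /distr_partial linearZ linearZ/=.
  rewrite -mulr_sumr => /eqP; rewrite mulf_eq0 signr_eq0 => /eqP h.
  exact: h.
pose mono (alpha : multi_index d k) := \prod_(i < d) xi ord0 i ^+ mi alpha i.
have I_cvg alpha : I alpha N @[N --> \oo] -->
    mono alpha * vcoord j (A alpha (Vintegral (fun x => wave xi b x *: u x))).
  have tw := truncated_wave_cvg k xi b0.
  have := Cn_cvg_iter (s := mi_seq alpha) _ tw.
  rewrite size_mi_seq leqnn => /(_ isT) [D1 _ [C DC] D2].
  have -> : mono alpha *
        vcoord j (A alpha (Vintegral (fun x => wave xi b x *: u x))) =
      vcoord j (A alpha (Vintegral
        (fun x => iter_partial (mi_seq alpha) (wave xi b0) x *: u x))).
    rewrite -vcoordZ -linearZ -VintegralZ; last first.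
      exact/coord_integrableM/iu/mbounded_wave.
    congr (vcoord _ (A _ (Vintegral _))); apply/funext => x.
    by rewrite iter_partial_wave prod_mi_seq size_mi_seq subrK scalerA.
  have -> : I alpha = fun N => vcoord j (A alpha (Vintegral
      (fun x => iter_partial (mi_seq alpha) (phi N) x *: u x))).
    by apply/funext => N; rewrite /I partial_miE.
  have bI N : mbounded (iter_partial (mi_seq alpha) (phi N)).
    by split; [have [] := D1 N|exists C => x; exact: DC].
  exact: (lfun_Vintegral_cvg (l := A alpha) iu bI DC D2).
have : \sum_alpha I alpha N @[N --> \oo] --> \sum_alpha
    mono alpha * vcoord j (A alpha (Vintegral (fun x => wave xi b x *: u x))).
  by apply: cvg_big => [|alpha _]; [exact: add_continuous|exact: I_cvg].
rewrite (_ : (fun N => _) = cst 0); last exact/funext.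
move=> /(cvg_unique (@norm_hausdorff _ _) (cvg_cst _)) sum0.
transitivity (\sum_alpha
  mono alpha * vcoord j (A alpha (Vintegral (fun x => wave xi b x *: u x))));
  last by rewrite -sum0.
rewrite /symbol sum_lfunE {1}/vcoord linear_sum/=; apply: eq_bigr => alpha _.
by rewrite scale_lfunE linearZ.
Qed.

(** The waves of frequency xi / n tend to the constant 1, and by homogeneity the
    integral of u against each of them is in the kernel of the symbol at xi. *)
Lemma symbol_mean (u : rV -> V) (xi : rV) :
  coord_integrable u -> distr_solution A u ->
  symbol A xi (Vintegral u) = 0.
Proof.
move=> iu Au; apply: vcoord_eq0 => j.
have wave_cvg x : wave (n.+1%:R^-1 *: xi) 0 x @[n --> \oo] --> (1 : R).
  suff : wave (n.+1%:R^-1 *: xi) 0 x @[n --> \oo] --> cos (0 * rVdot xi x).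
    by rewrite mul0r cos0.
  apply: continuous_cvg; first exact: continuous_cos.
  under eq_cvg do rewrite addr0 rVdotZl.
  exact: (cvgMr_tmp cvg_harmonic).
have := lfun_Vintegral_cvg (l := symbol A xi) (j := j) iu
  (fun n => mbounded_wave (n.+1%:R^-1 *: xi) 0) (fun n x => cos_max _) wave_cvg.
rewrite (_ : (fun n => _) = cst 0); last first.
  apply/funext => n.
  have := symbol_wave (n.+1%:R^-1 *: xi) 0 iu Au.
  rewrite symbol_homog => /eqP; rewrite scaler_eq0 expf_eq0 invr_eq0 pnatr_eq0.
  by rewrite andbF => /eqP ->; rewrite /vcoord linear0.
move=> /(cvg_unique (@norm_hausdorff _ _) (cvg_cst _)) mean0.
rewrite (_ : u = fun x => 1 *: u x); last by apply/funext => x; rewrite scale1r.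
by rewrite -mean0.
Qed.

End wave_integrals.

(** * Inner products, the wave cone and the theorem *)

Section dot_products.
Variables (R : realType) (V : vectType R) (dot : {dot V for idfun}).

Lemma dotC x y : dot x y = dot y x.
Proof. by rewrite (@hermC _ _ idfun) expr0 mul1r. Qed.

Lemma dotDl x y z : dot (x + y) z = dot x z + dot y z.
Proof. exact: linearDl. Qed.

Lemma dotZl (t : R) x z : dot (t *: x) z = t * dot x z.
Proof. exact: linearZl_LR. Qed.

Lemma dotDr x y z : dot z (x + y) = dot z x + dot z y.
Proof. exact: linearDr. Qed.

Lemma dotZr (t : R) x z : dot z (t *: x) = t * dot z x.
Proof. by rewrite dotC dotZl dotC. Qed.

Lemma dot0r z : dot z 0 = 0.
Proof. by rewrite -(scale0r 0) dotZr mul0r. Qed.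

Lemma dot_suml (I : finType) (F : I -> V) z :
  dot (\sum_i F i) z = \sum_i dot (F i) z.
Proof.
by apply: (big_morph (dot^~ z)) => [x y|]; rewrite ?dotDl// dotC dot0r.
Qed.

Lemma dot_ge0 x : 0 <= dot x x.
Proof.
have [->|x0] := eqVneq x 0; first by rewrite dot0r.
by rewrite ltW// neq0_dnorm_gt0.
Qed.

Lemma dot_cauchy_schwarz x y : `|dot x y| <= dotnorm dot x * dotnorm dot y.
Proof.
rewrite /dotnorm -sqrtrM ?dot_ge0// -sqrtr_sqr ler_wsqrtr//.
have [->|y0] := eqVneq y 0; first by rewrite !dot0r expr0n mulr0.
have yy : 0 < dot y y by exact: neq0_dnorm_gt0.
have := dot_ge0 (dot y y *: x + (- dot x y) *: y).
rewrite dotDl !dotDr !dotZl !dotZr (dotC y x) => h.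
rewrite -subr_ge0 -(pmulr_rge0 _ yy).
by apply: le_trans h _; rewrite le_eqVlt; apply/orP; left; apply/eqP; ring.
Qed.

(** The map sending r to its pairings with a basis is injective, since the form
    is definite, hence surjective. *)
Lemma dot_riesz (f : {linear V -> R^o}) : exists r, forall x, f x = dot x r.
Proof.
pose n := \dim {:V}.
pose T (r : V) : 'rV[R]_n := \row_(j < n) dot (vbasis {:V})`_j r.
have linT : linear T.
  by move=> t x y; apply/rowP => j; rewrite !mxE dotDr dotZr.
pose TL := GRing.isLinear.Build _ _ _ _ T linT.
pose T' : {linear V -> 'rV[R]_n} := HB.pack T TL.
have Tker : lker (linfun T') = 0%VS.
  apply/eqP; rewrite -subv0; apply/subvP => x; rewrite memv_ker lfunE memv0 /=.
  move=> /eqP/rowP Tx; apply: contraT => x0.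
  have : 0 < dot x x by exact: neq0_dnorm_gt0.
  rewrite {1}(coord_vbasis (memvf x)).
  suff -> : dot (\sum_j coord (vbasis {:V}) j x *: (vbasis {:V})`_j) x = 0.
    by rewrite ltxx.
  rewrite dot_suml big1// => j _.
  by have := Tx j; rewrite !mxE => Txj; rewrite dotZl Txj mulr0.
have Tim : limg (linfun T') = fullv.
  apply/eqP; rewrite eqEdim subvf/= limg_dim_eq; last by rewrite Tker capv0.
  by rewrite dimvf /dim/= mul1n.
have /memv_imgP[r _ rE] : \row_j (f (vbasis {:V})`_j : R) \in limg (linfun T').
  by rewrite Tim memvf.
exists r => x; rewrite {1 2}(coord_vbasis (memvf x)) linear_sum/=.
rewrite dot_suml; apply: eq_bigr => j _.
rewrite linearZ dotZl /=; congr (_ * _).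
by move/rowP: rE => /(_ j); rewrite lfunE !mxE.
Qed.

(** Comparison of the norm of the inner product with the coordinates in which
    integrals are taken. *)
Lemma vcoord_le_dotnorm (i : 'I_(\dim {:V})) :
  exists2 C, 0 <= C & forall x, `|vcoord i x| <= C * dotnorm dot x.
Proof.
have [r rE] := dot_riesz (coord (vbasis {:V}) i).
exists (dotnorm dot r) => [|x]; first exact: sqrtr_ge0.
by rewrite /vcoord rE mulrC; exact: dot_cauchy_schwarz.
Qed.

End dot_products.

Lemma L1_coord_integrable (R : realType) (d : nat) (V : vectType R)
    (dot : {dot V for idfun}) (u : 'rV[R]_d -> V) :
  L1 dot u -> coord_integrable u.
Proof.
move=> [mu_u iu] i; have [C C0 HC] := vcoord_le_dotnorm dot i.
apply: (le_integrable measurableT _ _ (integrableZl measurableT C iu)).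
  by apply/measurable_EFinP; exact: (mu_u i).
move=> x _; rewrite /= lee_fin (le_trans (HC _))// normrM ler_pM ?sqrtr_ge0//;
  exact: ler_norm.
Qed.

Lemma convex_cone_cone (R : realType) (V : vectType R) (K : set V) :
  convex_cone K -> K 0 -> cone K.
Proof.
move=> [Kconv Kpos] K0; split=> //.
- move=> x y Kx Ky.
  have h0 : (0 : R) <= 2^-1 by lra.
  have h1 : (2^-1 : R) <= 1 by lra.
  have := Kconv x y (Itv01 h0 h1) (mem_set Kx) (mem_set Ky).
  move=> /set_mem/(Kpos 2 _ (ltr0Sn _ 1)).
  rewrite (_ : 2 *: _ = x + y)//.
  rewrite [conv _ _ _]/(2^-1 *: x + (1 - 2^-1) *: y) scalerDr !scalerA.
  have -> : 2 * 2^-1 = 1 :> R by field.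
  have -> : 2 * (1 - 2^-1) = 1 :> R by field.
  by rewrite !scale1r.
- move=> t x; rewrite le_eqVlt => /predU1P[<- _|t0 Kx].
    by rewrite scale0r.
  exact: Kpos.
Qed.

Section wave_cone.
Variables (R : realType) (d k : nat) (V W : vectType R).
Variable A : pde_operator d k V W.

Lemma wave_cone_ker (xi : 'rV[R]_d) v : xi != 0 -> symbol A xi v = 0 ->
  wave_cone A v.
Proof.
move=> xi0 Av; pose t := Num.sqrt (\sum_(i < d) xi ord0 i ^+ 2).
have sq_ge0 i : 0 <= xi ord0 i ^+ 2 by exact: sqr_ge0.
have t0 : 0 < t.
  rewrite sqrtr_gt0 lt_neqAle sumr_ge0// andbT eq_sym.
  apply: contra xi0 => /eqP s0; apply/eqP/rowP => i; rewrite mxE; apply/eqP.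
  by rewrite -sqrf_eq0 (psumr_eq0P _ s0).
exists (t^-1 *: xi) => /=; last first.
  by rewrite memv_ker symbol_homog Av scaler0.
under eq_bigr do rewrite mxE exprMn.
rewrite -mulr_sumr sqrtrM ?sqr_ge0// sqrtr_sqr ger0_norm ?invr_ge0 ?ltW//.
by rewrite -/t mulVf// gt_eqF.
Qed.

End wave_cone.

Theorem proposition1p9 (R : realType) (d k : nat) (V W : vectType R)
    (dotV : {dot V for idfun}) (dotW : {dot W for idfun})
    (A : pde_operator d k V W) (K : set V) :
  convex_cone K ->
  K `&` wave_cone A = [set 0] ->
  forall u : 'rV[R]_d -> V,
    L1 dotV u ->
    distr_solution A u ->
    {ae lebesgue_rV R d, forall x, K (u x)} ->
    {ae lebesgue_rV R d, forall x, u x = 0}.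
Proof.
move=> cK KA u L1u Au uK; have iu := L1_coord_integrable L1u.
have KA0 v : K v -> wave_cone A v -> v = 0.
  by move=> Kv Av; have : (K `&` wave_cone A) v by []; rewrite KA.
(* That 0 is in the wave cone provides a unit vector, so that d > 0. *)
have [K0 [xi0 xi01 _]] : (K `&` wave_cone A) 0 by rewrite KA.
have {}cK := convex_cone_cone cK K0.
have xi0N0 : xi0 != 0.
  apply: contra_eq_neq xi01 => ->.
  rewrite big1 ?sqrtr0 1?eq_sym ?oner_eq0// => i _.
  by rewrite mxE expr0n.
have mean0 : Vintegral u = 0.
  apply: KA0; first exact: Vintegral_cone.
  by apply: (wave_cone_ker xi0N0); exact: symbol_mean.
have iwu xi b := coord_integrableM (mbounded_wave xi b) iu.
have wave0 xi b : Vintegral (fun x => wave xi b x *: u x) = 0.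
  apply: KA0.
    (* As the mean vanishes, the weight 1 + wave may replace the wave. *)
    rewrite -[X in K X]add0r -mean0 -VintegralD//.
    apply: (Vintegral_cone cK).
      have := coord_integrableM
        (mboundedD (mbounded_cst d 1) (mbounded_wave xi b)) iu.
      by under eq_fun do rewrite scalerDl scale1r.
    have [_ _ KZ] := cK; apply: filterS uK => x /(KZ (1 + wave xi b x)).
    rewrite scalerDl scale1r; apply.
    have := cos_max (rVdot xi x + b); rewrite ler_norml => /andP[].
    by rewrite /wave; lra.
  have [xi00|xiN0] := eqVneq xi 0; last first.
    by apply: (wave_cone_ker xiN0); exact: symbol_wave.
  apply: (wave_cone_ker xi0N0).
  rewrite (_ : (fun x => _) = fun x => cos b *: u x).
    by rewrite VintegralZ// linearZ/= symbol_mean// scaler0.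
  by apply/funext => x; rewrite xi00 /wave rVdot0l add0r.
have ui0 i : {ae lebesgue_rV R d, forall x, vcoord i (u x) = 0}.
  apply: fourier_null_ae0; split; first exact: iu.
  move=> xi b; have := congr1 (vcoord i) (wave0 xi b).
  rewrite vcoord_Vintegral [in RHS]/vcoord linear0 => <-.
  by apply: eq_Rintegral => x _; rewrite vcoordZ.
by apply: filterS (filter_forall _ ui0) => x; exact: vcoord_eq0.
Qed.
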